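(* Let $0<\alpha_2<\alpha_1<1$, $\lambda>0$, $C_1\ge0$, $C_2\ge0$ with $C_1+C_2=1$, $u>0$, $c>0$. Let $$\bar R^{\alpha_1,\alpha_2}(t)=u+ct-\sum_{i=1}^{N^{\alpha_1,\alpha_2}(t)}X_i,\quad t\ge0,$$ where the claim sizes $X_i$ are iid exponentially distributed with parameter $\mu>0$ and independent of the mixed fractional Poisson process $\{N^{\alpha_1,\alpha_2}(t)\}_{t\ge0}$. Let $T=\inf\{t>0:\bar R^{\alpha_1,\alpha_2}(t)<0\}$ be the ruin time (with $T=\infty$ if ruin never occurs), and let $\psi_u(t)=\mathrm{Pr}\{T\le t<\infty\}$ be the ruin probability in finite time $t$. Then its Laplace transform $\tilde\psi_u(s)=\int_0^\infty e^{-st}\psi_u(t)\,\mathrm{d}t$ is given by $$\tilde\psi_u(s)=s^{-1}y(s)\exp\{-u\mu(1-y(s))\},\quad s>0,$$ where $y(s)$ is a solution of $$y(s)=\frac{\lambda}{C_1\left(s+c\mu(1-y(s))\right)^{\alpha_1}+C_2\left(s+c\mu(1-y(s))\right)^{\alpha_2}+\lambda}.$$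
   Context: The mixed stable subordinator $\{D_{\alpha_1,\alpha_2}(t)\}_{t\ge0}$ is the subordinator (non-decreasing L\'evy process) with $\mathbb{E}(e^{-sD_{\alpha_1,\alpha_2}(t)})=e^{-t(C_1s^{\alpha_1}+C_2s^{\alpha_2})}$, $s\ge0$. Its inverse is $Y_{\alpha_1,\alpha_2}(t)=\inf\{s\ge0:D_{\alpha_1,\alpha_2}(s)>t\}$. The mixed fractional Poisson process (MFPP) is $N^{\alpha_1,\alpha_2}(t)=N(Y_{\alpha_1,\alpha_2}(t))$, where $\{N(t)\}_{t\ge0}$ is a homogeneous Poisson process with intensity $\lambda$ independent of $\{Y_{\alpha_1,\alpha_2}(t)\}_{t\ge0}$. The MFPP is a renewal process whose interarrival time has Laplace transform $\lambda/(C_1s^{\alpha_1}+C_2s^{\alpha_2}+\lambda)$, $s>0$. An exponential variable with parameter $\mu$ has density $\mu e^{-\mu x}$, $x>0$. *)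

(* Defs.v *)
From HB Require Import structures.
From mathcomp Require Import all_boot all_order all_algebra.
From mathcomp Require Import all_classical all_reals all_analysis.

Set Implicit Arguments.
Unset Strict Implicit.
Unset Printing Implicit Defensive.

Import Order.TTheory GRing.Theory Num.Theory.
Import numFieldNormedType.Exports.

Local Open Scope classical_set_scope.
Local Open Scope ring_scope.

(* Processes are families X : R -> T -> R (time, then sample point); only
   their values at times t >= 0 are ever constrained or used. Path properties
   (starting point, monotonicity, cadlag) are required on every path. *)

Section independence.
Context d (T : measurableType d) (R : realType) (P : probability T R).

Definition mutually_independent d' (U : measurableType d') (I : choiceType)
    (Z : I -> T -> U) : Prop :=
  forall (J : seq I) (B : I -> set U),
    uniq J -> (forall i, measurable (B i)) ->
    P (\bigcap_(i in [set` J]) (Z i @^-1` B i)) =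
    (\prod_(i <- J) P (Z i @^-1` B i))%E.

(* sigma(Z i, i in J) *)
Definition sigma_of d' (U : measurableType d') (I : Type) (J : set I)
    (Z : I -> T -> U) : set (set T) :=
  <<s \bigcup_(i in J) preimage_set_system setT (Z i) measurable >>.

Definition independent_systems (F G : set (set T)) : Prop :=
  forall A B, F A -> G B -> P (A `&` B) = (P A * P B)%E.

End independence.

Section processes.
Context d (T : measurableType d) (R : realType) (P : probability T R).

Definition time : set R := [set t | 0 <= t].

Definition cadlag (f : R -> R) : Prop :=
  (forall t : R, 0 <= t -> f s @[s --> t^'+] --> f t) /\
  (forall t : R, 0 < t -> cvg (f s @[s --> t^'-])).

(* A finite grid 0 <= t_0 <= ... <= t_n extends to a nondecreasing sequence
   by repeating t_n, so increments are indexed by nat. *)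
Definition independent_increments (X : R -> T -> R) : Prop :=
  forall t : nat -> R, 0 <= t 0%N -> nondecreasing_seq t ->
    mutually_independent P (fun (i : nat) w => X (t i.+1) w - X (t i) w).

Definition stationary_increments (X : R -> T -> R) : Prop :=
  forall s t : R, 0 <= s -> 0 <= t -> forall B, measurable B ->
    P ((fun w => X (s + t) w - X s w) @^-1` B) =
    P ((fun w => X t w - X 0 w) @^-1` B).

Record levy_process (X : R -> T -> R) : Prop := LevyProcess {
  levy_measurable : forall t : R, 0 <= t -> measurable_fun setT (X t) ;
  levy_start : forall w, X 0 w = 0 ;
  levy_independent : independent_increments X ;
  levy_stationary : stationary_increments X ;
  levy_cadlag : forall w, cadlag (X ^~ w) }.

Definition nondecreasing_paths (X : R -> T -> R) : Prop :=
  forall w (s t : R), 0 <= s -> s <= t -> X s w <= X t w.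

Definition subordinator (D : R -> T -> R) : Prop :=
  levy_process D /\ nondecreasing_paths D.

Definition mixed_stable_subordinator (C1 C2 alpha1 alpha2 : R)
    (D : R -> T -> R) : Prop :=
  subordinator D /\
  forall s t : R, 0 <= s -> 0 <= t ->
    'E_P[fun w => expR (- s * D t w)]%E =
    (expR (- t * (C1 * s `^ alpha1 + C2 * s `^ alpha2)))%:E.

(* inf {s >= 0 : D s > t}, as a real number: for a mixed stable subordinator
   with C1 + C2 = 1 the set is nonempty almost surely. *)
Definition inverse_subordinator (D : R -> T -> R) (t : R) (w : T) : R :=
  inf [set s | 0 <= s /\ t < D s w].

(* The law of N t is given for t > 0 only, because [poisson_pmf 0] is not a
   probability mass function; N 0 = 0 is part of [levy_process]. *)
Definition poisson_process (lambda : R) (N : R -> T -> nat) : Prop :=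
  [/\ levy_process (fun t w => (N t w)%:R),
      nondecreasing_paths (fun t w => (N t w)%:R) &
      forall (t : R) (k : nat), 0 < t ->
        P [set w | N t w = k] = (poisson_pmf (lambda * t) k)%:E].

Definition mixed_fractional_poisson (N : R -> T -> nat) (D : R -> T -> R)
    (t : R) (w : T) : nat :=
  N (inverse_subordinator D t w) w.

(* The equality of laws is restricted to measurable sets: outside of them the
   values of P and [exponential_prob] are meaningless. *)
Definition iid_exponential (mu : R) (X : nat -> {RV P >-> R}) : Prop :=
  mutually_independent P (fun (i : nat) => X i : T -> R) /\
  forall i B, measurable B -> distribution P (X i) B = exponential_prob mu B.

(* Claims are numbered from 0. *)
Definition risk_process (u c : R) (M : R -> T -> nat) (X : nat -> T -> R)
    (t : R) (w : T) : R :=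
  u + c * t - \sum_(i < M t w) X i w.

(* ereal_inf set0 = +oo, the value when ruin never occurs. *)
Definition ruin_time (U : R -> T -> R) (w : T) : \bar R :=
  ereal_inf [set t%:E | t in [set t | 0 < t /\ U t w < 0]].

(* As t is a real number, t < +oo holds automatically. *)
Definition ruin_probability (U : R -> T -> R) (t : R) : \bar R :=
  P [set w | (ruin_time U w <= t%:E)%E].

End processes.

Definition laplace_transform (R : realType) (f : R -> \bar R) (s : R) : \bar R :=
  (\int[lebesgue_measure]_(t in `[0%R, +oo[) ((expR (- s * t))%:E * f t))%E.

(* The equation for y(s). The first conjunct says that the real powers on the
   right-hand side make sense ([powR] is total, with junk values at negative
   bases). *)
Definition solves_ruin_equation (R : realType)
    (C1 C2 alpha1 alpha2 lambda mu c s y : R) : Prop :=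
  let z := s + c * mu * (1 - y) in
  0 <= z /\ y = lambda / (C1 * z `^ alpha1 + C2 * z `^ alpha2 + lambda).

(* Main.v *)
Require Import Defs.
From HB Require Import structures.
From mathcomp Require Import all_boot all_order all_algebra.
From mathcomp Require Import all_classical all_reals all_analysis.
From mathcomp Require Import measurable_realfun.
From mathcomp Require Import ring lra.

Import Order.TTheory GRing.Theory Num.Theory.
Import numFieldNormedType.Exports.

(** Put psi q = C1 q^alpha1 + C2 q^alpha2, the Laplace exponent of D, and for a
    solution y put r = mu (1 - y) and z = s + c r. The equation reads
    psi z = lambda (1/y - 1), and it forces 0 < y < 1 ([solution_in_unit]).

    The ruin problem is run in operational time x: there the number of claims
    is N x, calendar time is D x, and the surplus is u + c D x - S, where S is
    the sum of the first N x claims. Since E e^{rX} = 1/y, the weight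
    e^{-z D x + r S} has mean exp(- x psi z + lambda x (1/y - 1)) = 1, and it is
    a martingale. At ruin the last claim jumps over the barrier u + c D; by lack
    of memory the excess is exponential and contributes a factor 1/y, so the
    mean weight spent there is y^-1 e^{ru} E e^{-s D}, as z = s + c r
    ([exponential_overshoot]). Calendar time at ruin is the ruin time T, while
    the weight of paths not yet ruined at operational time x is at most
    e^{ru} e^{-s D x} and vanishes in mean. Optional stopping thus gives
    1 = y^-1 e^{ru} E(e^{-sT}; T finite), which is the claim, because the
    Laplace transform of t -> P(T <= t) is s^-1 E(e^{-sT}; T finite).

    Optional stopping is carried out on a grid of mesh h in operational time
    ([chain_total_ruin_mass_le], [chain_total_ruin_mass_ge]), after the Poisson
    process, the subordinator and the claims have been moved to independent
    coordinates ([ruin_probability_split]). Ruin on the grid differs from ruin,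
    but it bounds it on both sides: ruin implies grid ruin if the count of
    claims is read one step ahead ([ruin_grid_ruin]), and grid ruin implies ruin
    if it is read at the grid point ([grid_ruin_ruin]). Reading ahead costs a
    factor exp(lambda h (1/y - 1)). Steps with several claims, where the
    overshoot identity fails in one direction, have a total weight of order
    J h^2 over J steps. With h = 1/m^2 and J = m^3 both errors vanish, and so
    does the surviving weight ([ge1_of_grid_error]). *)

Set SsrOldRewriteGoalsOrder.
Set Implicit Arguments.
Unset Strict Implicit.
Unset Printing Implicit Defensive.

Local Open Scope classical_set_scope.
Local Open Scope ring_scope.

(** * Integrals over independent coordinates *)

Lemma measureE_integral_indic d (T : measurableType d) (R : realType)
    (m : {measure set T -> \bar R}) (A : set T) :
  measurable A -> m A = (\int[m]_w (\1_A w)%:E)%E.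
Proof. by move=> mA; rewrite integral_indic// setIT. Qed.

Section decoupling.
Context d (T : measurableType d) (R : realType) (P : probability T R).
Context d1 d2 (E1 : measurableType d1) (E2 : measurableType d2).
Variables (xi : T -> E1) (eta : T -> E2).
Hypotheses (mxi : measurable_fun setT xi) (meta : measurable_fun setT eta).
Hypothesis indep : forall A B, measurable A -> measurable B ->
  P (xi @^-1` A `&` eta @^-1` B) = (P (xi @^-1` A) * P (eta @^-1` B))%E.
Local Open Scope ereal_scope.

(** The joint law of two independent variables is the product of their laws,
    so Tonelli's theorem applies on the space of values. *)
Lemma integral_decoupling (h : E1 * E2 -> \bar R) :
  measurable_fun setT h -> (forall z, 0 <= h z) ->
  \int[P]_w h (xi w, eta w) = \int[P]_w \int[P]_w' h (xi w, eta w').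
Proof.
move=> mh h0.
pose X1 : {mfun T >-> E1} := HB.pack xi (isMeasurableFun.Build _ _ _ _ _ mxi).
pose X2 : {mfun T >-> E2} := HB.pack eta (isMeasurableFun.Build _ _ _ _ _ meta).
have mX : measurable_fun setT (fun w => (xi w, eta w)).
  exact: measurable_fun_pair.
pose X : {mfun T >-> (E1 * E2)%type} :=
  HB.pack (fun w => (xi w, eta w)) (isMeasurableFun.Build _ _ _ _ _ mX).
rewrite -(ge0_integral_distribution (P:=P) X mh h0).
rewrite (eq_measure_integral (distribution P X1 \x distribution P X2)); last first.
  by move=> A mA _; apply/esym; apply: product_measure_unique.
rewrite fubini_tonelli1//.
rewrite (ge0_integral_distribution (P:=P) X1); last 2 first.
- exact: (measurable_fun_fubini_tonelli_F h).
- by move=> x; apply: integral_ge0.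
apply: eq_integral => w _ /=.
rewrite /fubini_F (ge0_integral_distribution (P:=P) X2)//.
exact: measurableT_comp.
Qed.

Lemma integral_indep_prod (f : E1 -> \bar R) (g : E2 -> \bar R) :
  measurable_fun setT f -> (forall x, 0 <= f x) ->
  measurable_fun setT g -> (forall x, 0 <= g x) ->
  \int[P]_w (f (xi w) * g (eta w)) =
  (\int[P]_w f (xi w)) * \int[P]_w g (eta w).
Proof.
move=> mf f0 mg g0.
have mfg : measurable_fun setT (fun z : E1 * E2 => f z.1 * g z.2).
  by apply: emeasurable_funM; apply: measurableT_comp.
rewrite (integral_decoupling mfg); last by move=> z; rewrite mule_ge0.
transitivity (\int[P]_w (f (xi w) * \int[P]_w' g (eta w'))).
  by apply: eq_integral => w _ /=; rewrite ge0_integralZl//;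
    exact: measurableT_comp.
rewrite ge0_integralZr//; first exact: measurableT_comp.
by apply: integral_ge0.
Qed.

Lemma probability_decoupling (A : set (E1 * E2)) : measurable A ->
  P [set w | A (xi w, eta w)] = \int[P]_w P [set w' | A (xi w, eta w')].
Proof.
move=> mA.
have mX : measurable_fun setT (fun w => (xi w, eta w)).
  exact: measurable_fun_pair.
have mB : measurable [set w | A (xi w, eta w)].
  by rewrite -[X in measurable X]setTI; exact: mX.
rewrite measureE_integral_indic//.
rewrite (@integral_decoupling (fun z => (\1_A z)%:E))//; last first.
  by apply/measurable_EFinP; exact: measurable_indic.
apply: eq_integral => w _; rewrite measureE_integral_indic//.
rewrite -[X in measurable X]setTI.
exact: (measurableT_comp (measurable_fun_pair (measurable_cst (xi w)) meta)).
Qed.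

End decoupling.

(** * Freezing the past of an independent sequence *)

(** The cylinders over the first [n] terms. They generate the sigma-algebra
    carried by [past xi n], a copy of [T]: measurability of a function
    [past xi n -> _] says that it depends on the first [n] terms only. *)
Definition past_events T (R : realType) (xi : nat -> T -> R) n : set (set T) :=
  [set A | exists2 B : nat -> set R, (forall i, measurable (B i)) &
    A = \bigcap_(i in [set` iota 0 n]) (xi i @^-1` B i)].

Notation past xi n := (g_sigma_algebraType (past_events xi n)).

Section past.
Context d (T : measurableType d) (R : realType) (P : probability T R).
Variable xi : nat -> T -> R.
Hypothesis mxi : forall i, measurable_fun setT (xi i).

Lemma measurable_past n i : (i < n)%N ->
  measurable_fun setT (xi i : past xi n -> R).
Proof.
move=> ni _ B mB; rewrite setTI; apply: sub_sigma_algebra.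
exists (fun j => if j == i then B else setT); first by move=> j; case: ifP.
apply/seteqP; split => [w Bw j _ /=|w /(_ i)].
  by case: eqP => [->//|].
by rewrite /= eqxx; apply; rewrite mem_iota.
Qed.

Lemma past_events_measurable n : past_events xi n `<=` measurable.
Proof.
move=> _ [B mB ->]; apply: fin_bigcap_measurable => // i _.
by rewrite -[X in measurable X]setTI; exact: mxi.
Qed.

Lemma measurable_to_past n : measurable_fun setT (id : T -> past xi n).
Proof.
move=> _ A mA; rewrite setTI.
exact: (smallest_sub (@sigma_algebra_measurable _ T)
  (@past_events_measurable n)).
Qed.

Hypothesis indep : mutually_independent P xi.

(** Both sides are finite measures in [A]. They agree on the cylinders, which
    form a pi-system, by mutual independence, hence on all of the past. *)
Lemma past_indep n (A : set (past xi n)) (B : set R) :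
  measurable A -> measurable B ->
  P (A `&` xi n @^-1` B) = (P A * P (xi n @^-1` B))%E.
Proof.
move=> mA mB; set C := xi n @^-1` B.
have mC : measurable C by rewrite -[X in measurable X]setTI; exact: mxi.
have PC0 : 0 <= fine (P C) by rewrite fine_ge0.
rewrite (_ : P (A `&` C) = mrestr P mC A)// muleC -(@fineK _ (P C)); last first.
  exact: fin_num_measure.
rewrite (_ : (_ * P A)%E = mscale (NngNum PC0) P A)//.
apply: (@g_sigma_algebra_measure_unique _ _ _ (past_events xi n) _
  (fun=> setT)) => //.
- exact: past_events_measurable.
- move=> _; exists (fun=> setT) => //.
  by apply/seteqP; split.
- by rewrite bigcup_const//; exists 0%N.
- move=> _ _ [A1 mA1 ->] [A2 mA2 ->]; exists (fun i => A1 i `&` A2 i).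
    by move=> i; exact: measurableI.
  apply/seteqP; split => [w [h1 h2] i ni|w h].
    by split; [exact: h1|exact: h2].
  by split => i ni; have [] := h i ni.
- move=> _ [A' mA' ->].
  set A'' := \bigcap_(i in _) _.
  rewrite -[LHS]/(P (A'' `&` C)) -[RHS]/((fine (P C))%:E * P A'')%E /A''.
  rewrite fineK ?fin_num_measure//.
  pose B' i := if i == n then B else A' i.
  have mB' i : measurable (B' i) by rewrite /B'; case: ifP.
  have eB' i : (i < n)%N -> B' i = A' i.
    by move=> ni; rewrite /B' ltn_eqF.
  have eI m : (m <= n)%N -> \bigcap_(i in [set` iota 0 m]) xi i @^-1` A' i =
    \bigcap_(i in [set` iota 0 m]) xi i @^-1` B' i.
    move=> mn; apply: eq_bigcapr => i; rewrite /= mem_iota/= => im.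
    by rewrite eB'// (leq_trans im).
  rewrite eI// [in RHS]indep ?iota_uniq//.
  rewrite (_ : _ `&` C = \bigcap_(i in [set` iota 0 n.+1]) xi i @^-1` B' i).
    rewrite indep ?iota_uniq// -addn1 iotaD big_cat/= big_seq1 muleC add0n.
    by rewrite (_ : B' n = B)// /B' eqxx.
  apply/seteqP; split => [w [h1 h2] i|w h].
    rewrite -[X in X -> _]/(is_true (i \in iota 0 n.+1)) mem_iota add0n /=.
    rewrite ltnS leq_eqVlt => /orP[/eqP ->|ni].
      by rewrite /B' eqxx.
    by apply: h1; rewrite /= mem_iota.
  split=> [i|].
    rewrite /= mem_iota/= add0n => ni; apply: h.
    by change (i \in iota 0 n.+1); rewrite mem_iota add0n ltnS; exact: ltnW.
  have : n \in iota 0 n.+1 by rewrite mem_iota add0n ltnSn.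
  by move=> /h; rewrite /= /B' eqxx.
- by move=> _; rewrite /= /mrestr (le_lt_trans _ (ltry 1))// probability_le1//;
    exact: measurableI.
Qed.

Local Open Scope ereal_scope.

(** The term of index [n] is independent of the past, so the past may be held
    fixed while that term is integrated out. *)
Lemma integral_past_freeze n (h : past xi n * R -> \bar R) :
  measurable_fun setT h -> (forall z, 0 <= h z) ->
  \int[P]_w h (w, xi n w) = \int[P]_w \int[P]_w' h (w, xi n w').
Proof.
move=> mh h0; apply: (integral_decoupling _ _ _ mh h0) => //.
- exact: measurable_to_past.
- exact: past_indep.
Qed.

Lemma integral_past_prod n (g : past xi n -> \bar R) (f : R -> \bar R) :
  measurable_fun setT g -> (forall w, 0 <= g w) ->
  measurable_fun setT f -> (forall x, 0 <= f x) ->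
  \int[P]_w (g w * f (xi n w)) = (\int[P]_w g w) * \int[P]_w f (xi n w).
Proof.
move=> mg g0 mf f0.
apply: (integral_indep_prod _ _ _ mg g0 mf f0) => //.
- exact: measurable_to_past.
- exact: past_indep.
Qed.

End past.

(** * Exponential integrals and densities *)

Lemma measurable_boolR d (T : measurableType d) (R : realType) (b : T -> bool) :
  measurable_fun setT b -> measurable_fun setT (fun x => (b x)%:R : R).
Proof.
move=> mb; rewrite (_ : (fun _ => _) = \1_(b @^-1` [set true])).
  by apply: measurable_indic; rewrite -[X in measurable X]setTI; exact: mb.
apply/funext => x; rewrite indicE; congr (_%:R); congr nat_of_bool.
by apply/idP/idP => [bx|]; rewrite in_setE.
Qed.

Section exponential_integrals.
Context {R : realType}.
Local Notation leb := (@lebesgue_measure R).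

Lemma continuous_expNM (r : R) : continuous (fun x : R => expR (- r * x)).
Proof.
move=> x; apply: continuous_comp; last exact: continuous_expR.
exact: mulrl_continuous.
Qed.

Lemma continuous_MexpNM (c r : R) : continuous (fun x : R => c * expR (- r * x)).
Proof.
move=> x; apply: (@continuousM _ R^o (fun=> c) (fun x => expR (- r * x))).
  exact: cst_continuous.
exact: continuous_expNM.
Qed.

Lemma measurable_MexpNM (c r : R) (D : set R) :
  measurable_fun D (fun x : R => (c * expR (- r * x))%:E).
Proof.
apply/measurable_EFinP/measurable_funTS/measurable_funM => //.
by apply: measurableT_comp => //; exact: mulrl_measurable.
Qed.

Lemma integral_expR_tail (r v : R) : 0 < r ->
  (\int[leb]_(x in `[v, +oo[) (r * expR (- r * x))%:E = (expR (- r * v))%:E)%E.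
Proof.
move=> r0; rewrite (@ge0_continuous_FTC2y _ _ (fun x => - expR (- r * x)) v 0).
- by rewrite sub0e EFinN oppeK.
- by move=> x _; rewrite mulr_ge0 ?expR_ge0// ltW.
- by apply: continuous_subspaceT; exact: continuous_MexpNM.
- rewrite -oppr0; apply: cvgN.
  rewrite (_ : (fun x => expR (- r * x)) =
      (fun z => expR (- z)) \o (fun z => r * z)); last first.
    by apply: eq_fun => x; rewrite mulNr.
  apply: (@cvg_comp _ _ _ _ _ _ (pinfty_nbhs R)); last exact: cvgr_expR.
  exact: gt0_cvgMry.
- by move=> x _; exact: ex_derive.
- by apply: cvgN; apply/cvg_at_right_filter; exact: continuous_expNM.
- by move=> x _; rewrite derive1E derive_val -[(- r)%:A]/(- r * 1) mulr1 mulrN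
    opprK mulrC.
Qed.

End exponential_integrals.

Section density.
Context d (T : measurableType d) (R : realType).
Variables (m : {sigma_finite_measure set T -> \bar R})
  (nu : probability T R) (w : T -> R).
Hypotheses (mw : measurable_fun setT w) (w0 : forall x, 0 <= w x).
Hypothesis nuw : forall A, measurable A -> nu A = (\int[m]_(x in A) (w x)%:E)%E.
Local Open Scope ereal_scope.
Local Notation leb := (@lebesgue_measure R).

(** Layer cake: [f x] is the length of the interval from 0 to [f x], and
    exchanging [x] with the level [t] reduces the claim to indicators, where it
    is the hypothesis on the density. *)
Lemma ge0_integral_density (f : T -> R) : measurable_fun setT f ->
  (forall x, (0 <= f x)%R) ->
  \int[nu]_x (f x)%:E = \int[m]_x ((f x)%:E * (w x)%:E).
Proof.
move=> mf f0.
pose h (z : T * R) : \bar R := ((0 <= z.2) && (z.2 < f z.1))%R%:R%:E.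
have mh : measurable_fun setT h.
  apply/measurable_EFinP/measurable_boolR/measurable_and.
    by apply: measurable_fun_ler => //; exact: measurable_cst.
  by apply: measurable_fun_ltr => //; exact: measurableT_comp.
have h0 z : 0 <= h z by rewrite lee_fin.
have fE x : (f x)%:E = \int[leb]_t h (x, t).
  transitivity (leb `[0%R, f x[%classic).
    rewrite lebesgue_measure_itv/= lte_fin; case: ltP => [_|fx0].
      by rewrite sube0.
    by congr _%:E; apply/eqP; rewrite eq_le fx0 f0.
  rewrite measureE_integral_indic//; apply: eq_integral => t _.
  by rewrite /h indicE mem_setE in_itv.
transitivity (\int[leb]_t \int[nu]_x h (x, t)).
  by rewrite -fubini_tonelli//; apply: eq_integral => x _; exact: fE.
transitivity (\int[leb]_t \int[m]_x (h (x, t) * (w x)%:E)).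
  apply: eq_integral => t _.
  pose A := [set x | (0 <= t) && (t < f x)]%R.
  have mA : measurable A.
    rewrite -[A]setTI.
    rewrite (_ : A = (fun x => (0 <= t) && (t < f x))%R @^-1` [set true])//.
    by apply: measurable_and => //; exact: measurable_fun_ltr.
  have hA x : h (x, t) = (\1_A x)%:E.
    rewrite /h indicE; congr (_%:R%:E); congr nat_of_bool.
    by apply/idP/idP => [?|]; rewrite in_setE.
  under eq_integral do rewrite hA.
  transitivity (nu A); first by rewrite (measureE_integral_indic nu).
  rewrite nuw// integral_mkcond.
  by apply: eq_integral => x _; rewrite epatch_indic hA muleC.
transitivity (\int[m]_x \int[leb]_t (h (x, t) * (w x)%:E)); last first.
  apply: eq_integral => x _ /=; rewrite fE ge0_integralZr//.
    exact: measurableT_comp mh (pair1_measurable _).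
  by rewrite lee_fin.
apply/esym/(@fubini_tonelli _ _ _ _ _ m leb (fun z => h z * (w z.1)%:E)).
- apply: emeasurable_funM => //; apply/measurable_EFinP.
  exact: measurableT_comp.
- by move=> z; rewrite mule_ge0// lee_fin.
Qed.

End density.

(** * Overshoot of an exponential claim *)

Section claim_law.
Context d (T : measurableType d) (R : realType) (P : probability T R).
Variables (mu : R) (X : T -> R).
Hypotheses (mu_gt0 : 0 < mu) (mX : measurable_fun setT X).
Hypothesis X_law : forall B, measurable B ->
  P (X @^-1` B) = exponential_prob mu B.
Local Notation leb := (@lebesgue_measure R).
Local Open Scope ereal_scope.

Lemma integral_exponential_law (f : R -> R) : measurable_fun setT f ->
  (forall x, (0 <= f x)%R) ->
  \int[P]_w (f (X w))%:E =
  \int[leb]_x ((f x)%:E * (exponential_pdf mu x)%:E).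
Proof.
move=> mf f0.
have mX' : measurable_fun setT (X : T -> measurableTypeR R) := mX.
pose X' : {mfun T >-> measurableTypeR R} :=
  HB.pack (X : T -> measurableTypeR R) (isMeasurableFun.Build _ _ _ _ _ mX').
rewrite -(ge0_integral_density (m := leb) (nu := distribution P X'))//;
  last 2 first.
- exact: measurable_exponential_pdf.
- by move=> x; apply: exponential_pdf_ge0; exact: ltW.
rewrite ge0_integral_distribution//.
by apply/measurable_EFinP.
Qed.

Lemma exponential_moment_tail (r v : R) : (r < mu)%R -> (0 <= v)%R ->
  \int[P]_w (expR (r * X w) * (v < X w)%R%:R)%:E =
  (mu / (mu - r) * expR (- (mu - r) * v))%:E.
Proof.
move=> r_mu v0; have mr0 : (0 < mu - r)%R by rewrite subr_gt0.
rewrite (integral_exponential_law (f := fun x => expR (r * x) * (v < x)%R%:R)%R).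
rewrite (_ : (mu / (mu - r) * _)%:E = (mu / (mu - r))%:E *
    \int[leb]_(x in `[v, +oo[) ((mu - r) * expR (- (mu - r) * x))%:E); last first.
  by rewrite integral_expR_tail.
rewrite -integral_itv_obnd_cbnd; last first.
  exact: measurable_MexpNM.
rewrite -ge0_integralZl//; last 3 first.
- exact: measurable_MexpNM.
- by move=> x _; rewrite lee_fin mulr_ge0 ?expR_ge0// ltW.
- by rewrite lee_fin divr_ge0// ltW.
rewrite [RHS]integral_mkcond; apply: eq_integral => x _.
rewrite patchE mem_setE in_itv/= andbT; case: ifPn => vx.
  rewrite exponential_pdfE; last by rewrite (le_trans v0)// ltW.
  rewrite mulr1 -!EFinM; congr _%:E; rewrite [RHS]mulrA divfK ?gt_eqF// mulrCA.
  by rewrite -expRD; congr (_ * expR _)%R; ring.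
by rewrite mulr0 mul0e.
- apply: measurable_funM; last by apply: measurable_boolR; exact: measurable_fun_ltr.
  by apply: measurableT_comp => //; exact: mulrl_measurable.
- by move=> x; rewrite mulr_ge0 ?expR_ge0.
Qed.

(** The flag [b] holds on the support of the law. Besides the constant flag it
    serves for [v - S < x] with [v < S], a barrier that is already crossed. *)
Lemma exponential_moment (r : R) (b : R -> bool) : (r < mu)%R ->
  measurable_fun setT b -> (forall x, (0 <= x)%R -> b x) ->
  \int[P]_w (expR (r * X w) * (b (X w))%:R)%:E = (mu / (mu - r))%:E.
Proof.
move=> r_mu mb b1; have mr0 : (0 < mu - r)%R by rewrite subr_gt0.
rewrite (integral_exponential_law (f := fun x => expR (r * x) * (b x)%:R)%R).
- rewrite (_ : (mu / (mu - r))%:E = (mu / (mu - r))%:E *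
    \int[leb]_(x in `[0%R, +oo[) ((mu - r) * expR (- (mu - r) * x))%:E); last first.
    by rewrite integral_expR_tail// mulr0 expR0 mule1.
  rewrite -ge0_integralZl//; last 3 first.
  + exact: measurable_MexpNM.
  + by move=> x _; rewrite lee_fin mulr_ge0 ?expR_ge0// ltW.
  + by rewrite lee_fin divr_ge0// ltW.
  rewrite [RHS]integral_mkcond; apply: eq_integral => x _.
  rewrite patchE mem_setE in_itv/= andbT; case: ifPn => x0.
    rewrite exponential_pdfE// b1// mulr1 -!EFinM; congr _%:E.
    rewrite [RHS]mulrA divfK ?gt_eqF// mulrCA -expRD.
    by congr (_ * expR _)%R; ring.
  by rewrite lt0_exponential_pdf ?mule0// ltNge.
- apply: measurable_funM; last exact: measurable_boolR.
  by apply: measurableT_comp => //; exact: mulrl_measurable.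
- by move=> x; rewrite mulr_ge0 ?expR_ge0.
Qed.

Lemma measurable_claim_tail (r v : R) :
  measurable_fun setT (fun w => (expR (r * X w) * (v < X w)%R%:R)%:E).
Proof.
apply/measurable_EFinP/measurable_funM.
  by apply: measurableT_comp => //; exact: measurable_funM.
by apply: measurable_boolR; exact: measurable_fun_ltr.
Qed.

Let shift_tail (r S v : R) :
  \int[P]_w (expR (r * (S + X w)) * (v < S + X w)%R%:R)%:E =
  (expR (r * S))%:E * \int[P]_w (expR (r * X w) * (v - S < X w)%R%:R)%:E.
Proof.
rewrite -ge0_integralZl//; last exact: measurable_claim_tail.
by apply: eq_integral => w _; rewrite mulrDr expRD -mulrA ltrBlDl EFinM.
Qed.

Let tail_prob (S v : R) : \int[P]_w (v < S + X w)%R%:R%:E =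
  \int[P]_w (expR (0 * X w) * (v - S < X w)%R%:R)%:E.
Proof. by apply: eq_integral => w _; rewrite mul0r expR0 mul1r ltrBlDl. Qed.

(** Lack of memory: given that [S + X] exceeds a barrier [v] not below [S], the
    excess over [v] is again exponential, so it contributes the factor
    E e^{rX} = mu / (mu - r), whatever [S] is. *)
Lemma exponential_overshoot (r S v : R) : (r < mu)%R -> (S <= v)%R ->
  \int[P]_w (expR (r * (S + X w)) * (v < S + X w)%R%:R)%:E =
  (mu / (mu - r) * expR (r * v))%:E * (\int[P]_w (v < S + X w)%R%:R%:E).
Proof.
move=> r_mu Sv; rewrite shift_tail tail_prob.
rewrite !exponential_moment_tail ?subr_ge0//.
rewrite subr0 divff ?gt_eqF// mul1r -!EFinM; congr (_%:E).
rewrite mulrCA -[RHS]mulrA -!expRD; congr (_ * expR _)%R; ring.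
Qed.

(** When [S] is beyond the barrier before the claim, the weight at the crossing
    is only larger than in the lack-of-memory identity. *)
Lemma exponential_overshoot_ge (r S v : R) : (0 <= r < mu)%R ->
  (mu / (mu - r) * expR (r * v))%:E * (\int[P]_w (v < S + X w)%R%:R%:E)
  <= \int[P]_w (expR (r * (S + X w)) * (v < S + X w)%R%:R)%:E.
Proof.
move=> /andP[r0 r_mu]; have [Sv|vS] := leP S v.
  by rewrite exponential_overshoot.
have b1 x : (0 <= x)%R -> (v - S < x)%R by apply: lt_le_trans; rewrite subr_lt0.
have mb : measurable_fun setT (fun x : R => (v - S < x)%R).
  exact: measurable_fun_ltr.
rewrite shift_tail tail_prob !exponential_moment//.
rewrite subr0 divff ?gt_eqF// mule1 -EFinM lee_fin mulrC ler_wpM2r//.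
  by rewrite divr_ge0 ?subr_ge0 ?(ltW mu_gt0) ?(ltW r_mu).
by rewrite ler_expR ler_wpM2l// ltW.
Qed.

End claim_law.

(** * Exponential weight of the claims along a fixed path of counts *)

Definition total_claims (R : realType) (x : nat -> R) k : R := \sum_(i < k) x i.

Lemma probability_integral_cst d (T : measurableType d) (R : realType)
    (P : probability T R) (k : \bar R) : (\int[P]_w k = k)%E.
Proof. by rewrite integral_cst// -[RHS]mule1; congr *%E; exact: probability_setT. Qed.

Section survival.
Context {R : realType}.
Variables (x : nat -> R) (n : nat -> nat) (b : nat -> R).

(** The barrier is tested at the steps strictly before [j]: thus
    [survives_before 0] is true, and [ruined_at j] singles out the first step
    at which the claims exceed the barrier. *)
Fixpoint survives_before j : bool :=
  if j is i.+1 then (total_claims x (n i) <= b i) && survives_before i else true.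

Definition ruined_at j : bool :=
  survives_before j && (b j < total_claims x (n j)).

End survival.

Section claims.
Context d (T : measurableType d) (R : realType) (P : probability T R).
Variables (mu y : R) (X : nat -> T -> R).
Hypotheses (mu_gt0 : 0 < mu) (y_gt0 : 0 < y) (y_lt1 : y < 1).
Hypothesis mX : forall i, measurable_fun setT (X i).
Hypothesis X_indep : mutually_independent P X.
Hypothesis X_law : forall i B, measurable B ->
  P (X i @^-1` B) = exponential_prob mu B.
Local Notation S k w := (total_claims (X^~ w) k).
Local Notation r := (mu * (1 - y)).
Local Open Scope ereal_scope.

Lemma measurable_past_total k n : (k <= n)%N ->
  measurable_fun setT (fun w : past X n => S k w).
Proof.
move=> kn; rewrite /total_claims; elim: k kn => [|k IH] kn.
  by under eq_fun do rewrite big_ord0; exact: measurable_cst.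
under eq_fun do rewrite big_ord_recr /=.
by apply: measurable_funD; [apply: IH; exact: ltnW|exact: measurable_past].
Qed.

Lemma measurable_past_survives (n : nat -> nat) (b : nat -> R) j k :
  (forall i, (i < j)%N -> (n i <= k)%N) ->
  measurable_fun setT (fun w : past X k => survives_before (X^~ w) n b j).
Proof.
elim: j => [|j IH] nk /=; first exact: measurable_cst.
apply: measurable_and; last by apply: IH => i ij; apply: nk; exact: ltnW.
by apply: measurable_fun_ler => //; apply: measurable_past_total; exact: nk.
Qed.

Let r_ge0 : (0 <= r)%R.
Proof. by rewrite mulr_ge0 ?subr_ge0 ?(ltW mu_gt0) ?(ltW y_lt1). Qed.

Let r_lt : (r < mu)%R.
Proof. by rewrite gtr_pMr// gtrBl. Qed.

Let rate_ratio : (mu / (mu - r) = y^-1)%R.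
Proof.
have -> : (mu - r = mu * y)%R by ring.
by rewrite invfM mulrA divff ?gt_eqF// mul1r.
Qed.

Let measurable_past_weight k (V : past X k -> R) : measurable_fun setT V ->
  measurable_fun setT (fun w : past X k => (expR (r * S k w) * V w)%:E).
Proof.
move=> mV; apply/measurable_EFinP/measurable_funM => //.
apply: measurableT_comp => //; apply: measurable_funM => //.
exact: measurable_past_total.
Qed.

(** A further claim is independent of the preceding ones and multiplies the
    weight e^{rS} by E e^{rX}, which is 1/y for r = mu (1 - y). *)
Lemma weight_next_claim k (V : past X k -> R) :
  measurable_fun setT V -> (forall w, (0 <= V w)%R) ->
  \int[P]_w (expR (r * S k.+1 w) * V w)%:E =
  (y^-1)%:E * \int[P]_w (expR (r * S k w) * V w)%:E.
Proof.
move=> mV V0.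
transitivity (\int[P]_w ((expR (r * S k w) * V w)%:E * (expR (r * X k w))%:E)).
  apply: eq_integral => w _.
  by rewrite /total_claims big_ord_recr/= mulrDr expRD mulrAC EFinM.
rewrite (integral_past_prod (xi := X) (n := k) mX X_indep
  (g := fun w => (expR (r * S k w) * V w)%:E) (f := fun x => (expR (r * x))%:E)).
- rewrite muleC; congr *%E.
  transitivity (\int[P]_w (expR (r * X k w) * ((fun=> true) (X k w))%:R)%:E).
    by apply: eq_integral => w _; rewrite mulr1.
  rewrite -rate_ratio.
  exact: (exponential_moment mu_gt0 (mX k) (@X_law k) (b := fun=> true) r_lt).
- exact: measurable_past_weight.
- by move=> w; rewrite lee_fin mulr_ge0 ?expR_ge0.
- by apply/measurable_EFinP; apply: measurableT_comp => //; exact: mulrl_measurable.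
- by move=> x; rewrite lee_fin expR_ge0.
Qed.

Lemma weight_next_claims (n : nat -> nat) (b : nat -> R) j k m :
  (forall i, (i < j)%N -> (n i <= k)%N) ->
  \int[P]_w (expR (r * S (k + m) w) * (survives_before (X^~ w) n b j)%:R)%:E =
  (y^-1 ^+ m)%:E *
  \int[P]_w (expR (r * S k w) * (survives_before (X^~ w) n b j)%:R)%:E.
Proof.
move=> nk; elim: m => [|m IH]; first by rewrite addn0 expr0 mul1e.
rewrite addnS (@weight_next_claim (k + m) (fun w => (survives_before _ n b j)%:R)).
- by rewrite IH muleA -EFinM exprS.
- apply: measurable_boolR; apply: measurable_past_survives => i /nk ik.
  exact: leq_trans (leq_addr _ _).
- by [].
Qed.

Let measurable_next_overshoot k (v a : R) :
  measurable_fun setT (fun w : past X k => \int[P]_w'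
     (expR (a * (S k w + X k w')) * (v < S k w + X k w')%R%:R)%:E).
Proof.
have mS : measurable_fun setT (fun z : past X k * T => (S k z.1 + X k z.2)%R).
  apply: measurable_funD.
    exact: (measurableT_comp (measurable_past_total (leqnn k)) measurable_fst).
  exact: (measurableT_comp (mX k) measurable_snd).
apply: (measurable_fun_fubini_tonelli_F (m2 := P) (fun z : past X k * T =>
  (expR (a * (S k z.1 + X k z.2)) * (v < S k z.1 + X k z.2)%R%:R)%:E)).
- apply/measurable_EFinP/measurable_funM.
    by apply: measurableT_comp => //; exact: measurable_funM.
  exact/measurable_boolR/measurable_fun_ltr.
- by move=> z; rewrite lee_fin mulr_ge0 ?expR_ge0.
Qed.

Let measurable_next_weighted k (V : past X k -> bool) (v a : R) :
  measurable_fun setT V ->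
  measurable_fun setT (fun w : T => (V w)%:R%:E * \int[P]_w'
     (expR (a * (S k w + X k w')) * (v < S k w + X k w')%R%:R)%:E).
Proof.
move=> mV; apply: emeasurable_funM.
  apply/measurable_EFinP/measurable_boolR.
  exact: (measurableT_comp mV (measurable_to_past mX (n := k))).
exact: (measurableT_comp (@measurable_next_overshoot k v a) (measurable_to_past mX (n := k))).
Qed.

Let next_tailE k (v : R) w : \int[P]_w' (v < S k w + X k w')%R%:R%:E =
  \int[P]_w' (expR (0 * (S k w + X k w')) * (v < S k w + X k w')%R%:R)%:E.
Proof. by apply: eq_integral => w' _; rewrite mul0r expR0 mul1r. Qed.

Let weighted_ge0 (V : bool) (f : T -> \bar R) : (forall w, 0 <= f w) ->
  0 <= V%:R%:E * \int[P]_w' f w'.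
Proof. by move=> f0; rewrite mule_ge0 ?lee_fin// integral_ge0. Qed.

(* Here [V] is an event about the first [k] claims, which are held fixed while
   the claim of index [k] is integrated. *)
Let overshoot_freeze k (V : past X k -> bool) (v a : R) :
  measurable_fun setT V ->
  \int[P]_w (expR (a * S k.+1 w) * (V w && (v < S k.+1 w)%R)%:R)%:E =
  \int[P]_w ((V w)%:R%:E * \int[P]_w'
     (expR (a * (S k w + X k w')) * (v < S k w + X k w')%R%:R)%:E).
Proof.
move=> mV.
pose h (z : past X k * R) : \bar R :=
  (expR (a * (S k z.1 + z.2)) * (V z.1 && (v < S k z.1 + z.2)%R)%:R)%:E.
have mS : measurable_fun setT (fun z : past X k * R => (S k z.1 + z.2)%R).
  apply: measurable_funD => //.
  exact: (measurableT_comp (measurable_past_total (leqnn k)) measurable_fst).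
have mh : measurable_fun setT h.
  apply/measurable_EFinP/measurable_funM.
    by apply: measurableT_comp => //; exact: measurable_funM.
  apply/measurable_boolR/measurable_and.
    exact: (measurableT_comp mV measurable_fst).
  exact: measurable_fun_ltr.
have h0 z : 0 <= h z by rewrite lee_fin mulr_ge0 ?expR_ge0.
transitivity (\int[P]_w h (w, X k w)).
  by apply: eq_integral => w _; rewrite /h /total_claims big_ord_recr.
rewrite (integral_past_freeze mX X_indep mh h0); apply: eq_integral => w _.
rewrite -ge0_integralZl//; last first.
  apply/measurable_EFinP/measurable_funM.
    by apply: measurableT_comp => //; apply: measurable_funM => //;
      exact: measurable_funD.
  by apply: measurable_boolR; apply: measurable_fun_ltr => //;
    exact: measurable_funD.
apply: eq_integral => w' _; rewrite /h/= -EFinM mulrCA.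
by case: (V w); rewrite ?mul1r ?mul0r ?mulr0.
Qed.

Let indicator_freeze k (V : past X k -> bool) (v : R) :
  measurable_fun setT V ->
  \int[P]_w (V w && (v < S k.+1 w)%R)%:R%:E =
  \int[P]_w ((V w)%:R%:E * \int[P]_w' (v < S k w + X k w')%R%:R%:E).
Proof.
move=> mV; under [RHS]eq_integral do rewrite next_tailE.
rewrite -overshoot_freeze//.
by apply: eq_integral => w _; rewrite mul0r expR0 mul1r.
Qed.

Lemma overshoot_weight_ge k (V : past X k -> bool) (v : R) :
  measurable_fun setT V ->
  (y^-1 * expR (r * v))%:E * \int[P]_w (V w && (v < S k.+1 w)%R)%:R%:E <=
  \int[P]_w (expR (r * S k.+1 w) * (V w && (v < S k.+1 w)%R)%:R)%:E.
Proof.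
move=> mV; rewrite overshoot_freeze// indicator_freeze//.
under eq_integral do rewrite next_tailE.
have c0 : (0 <= y^-1 * expR (r * v))%R.
  by rewrite mulr_ge0 ?expR_ge0// invr_ge0 ltW.
have t0 a w w' :
  0 <= (expR (a * (S k w + X k w')) * (v < S k w + X k w')%R%:R)%:E :> \bar R.
  by rewrite lee_fin mulr_ge0 ?expR_ge0.
rewrite -ge0_integralZl//; last 2 first.
- exact: measurable_next_weighted.
- by move=> w _; apply: weighted_ge0.
apply: ge0_le_integral => //.
- by move=> w _; rewrite mule_ge0 ?lee_fin//; exact: weighted_ge0.
- by apply: emeasurable_funM => //; exact: measurable_next_weighted.
- exact: measurable_next_weighted.
move=> w _; rewrite -next_tailE; rewrite muleCA lee_wpmul2l// -rate_ratio.
by apply: exponential_overshoot_ge => //; [exact: X_law|exact/andP].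
Qed.

Lemma overshoot_weight k (V : past X k -> bool) (v : R) :
  measurable_fun setT V -> (forall w, V w -> S k w <= v)%R ->
  \int[P]_w (expR (r * S k.+1 w) * (V w && (v < S k.+1 w)%R)%:R)%:E =
  (y^-1 * expR (r * v))%:E * \int[P]_w (V w && (v < S k.+1 w)%R)%:R%:E.
Proof.
move=> mV Vv; rewrite overshoot_freeze// indicator_freeze//.
have c0 : (0 <= y^-1 * expR (r * v))%R.
  by rewrite mulr_ge0 ?expR_ge0// invr_ge0 ltW.
rewrite -ge0_integralZl//; last 2 first.
- by under eq_fun do rewrite next_tailE; exact: measurable_next_weighted.
- by move=> w _; apply: weighted_ge0 => w'; rewrite lee_fin.
apply: eq_integral => w _; case: (boolP (V w)) => Vw.
  by rewrite !mul1e (exponential_overshoot mu_gt0 (mX k) (@X_law k)) ?Vv// rate_ratio.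
by rewrite !mul0e mule0.
Qed.

Section first_ruin.
Variables (n : nat -> nat) (b : nat -> R).
Hypotheses (n_nd : forall j, (n j <= n j.+1)%N) (b_nd : forall j, (b j <= b j.+1)%R).
Hypothesis b0 : (0 <= b 0%N)%R.

Let n_mono i j : (i <= j)%N -> (n i <= n j)%N.
Proof. exact: (homo_leq leqnn leq_trans n_nd). Qed.

Let past_survives k j : (forall i, (i < j)%N -> (n i <= k)%N) ->
  measurable_fun setT (fun w : past X k => survives_before (X^~ w) n b j).
Proof. exact: measurable_past_survives. Qed.

Let no_ruin_without_claim j w : (if j is i.+1 then n i == n j else n j == 0%N) ->
  ruined_at (X^~ w) n b j = false.
Proof.
rewrite /ruined_at; case: j => [|j] /eqP nj /=.
  by rewrite nj /total_claims big_ord0 ltNge b0.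
apply/negP => /andP[/andP[Sb _]]; rewrite -nj ltNge.
by rewrite (le_trans Sb).
Qed.

(** Only the last claim of step [j] is integrated. Earlier claims of the same
    step may have crossed the barrier already, in which case the overshoot
    estimate still holds in this direction. *)
Lemma first_ruin_weight_ge j :
  (y^-1 * expR (r * b j))%:E * \int[P]_w (ruined_at (X^~ w) n b j)%:R%:E <=
  \int[P]_w (expR (r * S (n j) w) * (ruined_at (X^~ w) n b j)%:R)%:E.
Proof.
case: (boolP (if j is i.+1 then n i == n j else n j == 0%N)) => [nj|nj].
  under eq_integral do rewrite no_ruin_without_claim//.
  under [leRHS]eq_integral do rewrite no_ruin_without_claim// mulr0.
  by rewrite integral0 mule0.
have [k nk] : exists k, n j = k.+1.
  exists (n j).-1; rewrite prednK// lt0n; case: j nj => [//|i] nj.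
  by apply: contra nj => /eqP nj0; rewrite eqn_leq n_nd nj0.
have nik i : (i < j)%N -> (n i <= k)%N.
  move=> ij; have : (n i < n j)%N; last by rewrite nk.
  case: j nj ij {nk} => [//|j] nj ij; apply: (@leq_ltn_trans (n j)); first exact: n_mono.
  by rewrite ltn_neqAle nj n_nd.
rewrite /ruined_at nk; apply: (@overshoot_weight_ge k
  (fun w => survives_before (X^~ w) n b j)).
exact: past_survives.
Qed.

Lemma weight_next_step j :
  \int[P]_w (expR (r * S (n j.+1) w) * (survives_before (X^~ w) n b j.+1)%:R)%:E =
  (y^-1 ^+ (n j.+1 - n j))%:E *
  \int[P]_w (expR (r * S (n j) w) * (survives_before (X^~ w) n b j.+1)%:R)%:E.
Proof.
rewrite -{1}(subnKC (n_nd j)); apply: weight_next_claims => i ij; exact: n_mono.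
Qed.

Lemma weight_at_start :
  \int[P]_w (expR (r * S (n 0%N) w))%:E = (y^-1 ^+ n 0%N)%:E.
Proof.
have := @weight_next_claims n (fun=> 0%R) 0%N 0%N (n 0%N) (fun _ => ltac:(by [])).
rewrite add0n; under eq_integral do rewrite mulr1; move=> ->.
under eq_integral do rewrite /total_claims big_ord0 mulr0 expR0 mulr1.
by rewrite probability_integral_cst mule1.
Qed.

Let measurable_total k : measurable_fun setT (fun w : T => S k w).
Proof.
exact: (measurableT_comp (measurable_past_total (leqnn k))
  (measurable_to_past mX (n := k))).
Qed.

Let measurable_survives j :
  measurable_fun setT (fun w : T => survives_before (X^~ w) n b j).
Proof.
exact: (measurableT_comp
  (@past_survives (n j) j (fun i ij => n_mono (ltnW ij)))
  (measurable_to_past mX (n := n j))).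
Qed.

Let measurable_ruined j :
  measurable_fun setT (fun w : T => ruined_at (X^~ w) n b j).
Proof. by apply: measurable_and => //; exact: measurable_fun_ltr. Qed.

Let measurable_weight j (V : T -> bool) : measurable_fun setT V ->
  measurable_fun setT (fun w => (expR (r * S (n j) w) * (V w)%:R)%:E).
Proof.
move=> mV; apply/measurable_EFinP/measurable_funM; last exact: measurable_boolR.
by apply: measurableT_comp => //; exact: measurable_funM.
Qed.

(** If step [j.+1] brings exactly one claim, the total before it is at most
    [b j <= b j.+1] and the overshoot identity is exact; if it brings none,
    there is no ruin. Steps with two claims or more go into the last term. *)
Lemma first_ruin_weight_le j :
  \int[P]_w (expR (r * S (n j.+1) w) * (ruined_at (X^~ w) n b j.+1)%:R)%:E <=
  (y^-1 * expR (r * b j.+1))%:E *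
    \int[P]_w (ruined_at (X^~ w) n b j.+1)%:R%:E +
  (1 < n j.+1 - n j)%N%:R%:E *
  \int[P]_w (expR (r * S (n j.+1) w) * (survives_before (X^~ w) n b j.+1)%:R)%:E.
Proof.
have i0 : 0 <= (y^-1 * expR (r * b j.+1))%:E *
    \int[P]_w (ruined_at (X^~ w) n b j.+1)%:R%:E.
  rewrite mule_ge0 ?lee_fin ?mulr_ge0 ?expR_ge0 ?invr_ge0 ?(ltW y_gt0)//.
  by apply: integral_ge0 => w _; rewrite lee_fin.
case: ltnP => nj.
  rewrite mul1e; apply: le_trans (leeDr _ i0).
  apply: ge0_le_integral => //.
  - exact: measurable_weight.
  - exact: measurable_weight.
  - move=> w _; rewrite lee_fin ler_wpM2l ?expR_ge0//.
    by rewrite /ruined_at; case: survives_before => //=; case: ltP.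
rewrite mul0e adde0; move: nj; rewrite leq_eqVlt ltnS leqn0 => /orP[/eqP nj|nj].
  have nS : n j.+1 = (n j).+1 by rewrite -(subnK (n_nd j)) nj.
  rewrite /ruined_at nS le_eqVlt (@overshoot_weight (n j)
    (fun w => survives_before (X^~ w) n b j.+1)) ?eqxx//.
    by apply: past_survives => i ij; exact: n_mono.
  by move=> w /= /andP[Sb _]; rewrite (le_trans Sb).
have nE : n j == n j.+1 by rewrite eqn_leq n_nd -subn_eq0.
under eq_integral do rewrite (@no_ruin_without_claim j.+1)// mulr0.
by rewrite integral0.
Qed.

Lemma weight_split j :
  \int[P]_w (expR (r * S (n j) w) * (survives_before (X^~ w) n b j)%:R)%:E =
  \int[P]_w (expR (r * S (n j) w) * (survives_before (X^~ w) n b j.+1)%:R)%:E +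
  \int[P]_w (expR (r * S (n j) w) * (ruined_at (X^~ w) n b j)%:R)%:E.
Proof.
rewrite -ge0_integralD//; last 2 first.
- exact: measurable_weight.
- exact: measurable_weight.
apply: eq_integral => w _; rewrite -EFinD -mulrDr; congr (_ * _)%:E.
rewrite /ruined_at /= andbC ltNge.
by case: survives_before; case: (S (n j) w <= b j)%R; rewrite /= ?addr0 ?add0r.
Qed.

Lemma survival_weight_le j :
  \int[P]_w (expR (r * S (n j) w) * (survives_before (X^~ w) n b j.+1)%:R)%:E
  <= (expR (r * b j))%:E.
Proof.
rewrite -[leRHS](probability_integral_cst P).
apply: ge0_le_integral => //.
  exact: measurable_weight.
move=> w _; rewrite lee_fin /=; case: (leP (S (n j) w) (b j)) => Sb/=; last first.
  by rewrite mulr0 expR_ge0.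
apply: (@le_trans _ _ (expR (r * S (n j) w))); last first.
  by rewrite ler_expR ler_wpM2l.
by rewrite ler_piMr ?expR_ge0// lern1 leq_b1.
Qed.

End first_ruin.

End claims.

(** * Measurability with a random number of claims *)

Section random_chain_measurability.
Context d1 d2 d3 (T1 : measurableType d1) (T2 : measurableType d2)
  (T3 : measurableType d3) (R : realType) (P : probability T3 R).
Variables (n : nat -> T1 -> nat) (b : nat -> T2 -> R) (X : nat -> T3 -> R).
Variable J : nat.
Hypothesis mn : forall j, (j <= J)%N -> measurable_fun setT (n j).
Hypothesis mb : forall j, (j <= J)%N -> measurable_fun setT (b j).
Hypothesis mX : forall i, measurable_fun setT (X i).

Lemma measurable_total k : measurable_fun setT (fun w => total_claims (X^~ w) k).
Proof.
rewrite /total_claims; elim: k => [|k IH].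
  by under eq_fun do rewrite big_ord0; exact: measurable_cst.
by under eq_fun do rewrite big_ord_recr /=; exact: measurable_funD.
Qed.

Lemma measurable_random_total (k : T1 -> nat) : measurable_fun setT k ->
  measurable_fun setT
    (fun w : T1 * T2 * T3 => total_claims (X^~ w.2) (k w.1.1)).
Proof.
move=> mk _ B mB; rewrite setTI.
rewrite (_ : _ @^-1` B = \bigcup_i ((k @^-1` [set i]) `*` setT `*`
    ((fun w => total_claims (X^~ w) i) @^-1` B))).
  apply: bigcupT_measurable => i; apply: measurableX.
    apply: measurableX => //.
    by rewrite -[X in measurable X]setTI; exact: mk.
  by rewrite -[X in measurable X]setTI; exact: measurable_total.
apply/seteqP; split => [[[w1 w2] w3] /= Bw|[[w1 w2] w3] [i _ [[/= <- _]]]//].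
by exists (k w1).
Qed.

Lemma measurable_random_survives j : (j <= J.+1)%N -> measurable_fun setT
  (fun w : T1 * T2 * T3 =>
    survives_before (X^~ w.2) (n^~ w.1.1) (b^~ w.1.2) j).
Proof.
elim: j => [_|j IH jJ] /=; first exact: measurable_cst.
apply: measurable_and; last by apply: IH; exact: ltnW.
apply: measurable_fun_ler; first by apply: measurable_random_total; exact: mn.
apply: (measurableT_comp (mb jJ)).
exact: (measurableT_comp measurable_snd measurable_fst).
Qed.

Lemma measurable_random_ruined j : (j <= J)%N -> measurable_fun setT
  (fun w : T1 * T2 * T3 => ruined_at (X^~ w.2) (n^~ w.1.1) (b^~ w.1.2) j).
Proof.
move=> jJ; apply: measurable_and.
  by apply: measurable_random_survives; exact: leqW.
apply: measurable_fun_ltr; last by apply: measurable_random_total; exact: mn.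
apply: (measurableT_comp (mb jJ)).
exact: (measurableT_comp measurable_snd measurable_fst).
Qed.

Lemma measurable_weight_integral (r : R) (k : T1 -> nat)
    (V : T1 * T2 * T3 -> bool) :
  measurable_fun setT k -> measurable_fun setT V ->
  measurable_fun setT (fun w : T1 * T2 => \int[P]_w3
    (expR (r * total_claims (X^~ w3) (k w.1)) * (V (w, w3))%:R)%:E)%E.
Proof.
move=> mk mV.
apply: (measurable_fun_fubini_tonelli_F (m2 := P) (fun w : T1 * T2 * T3 =>
  (expR (r * total_claims (X^~ w.2) (k w.1.1)) * (V w)%:R)%:E)) => [|w].
  apply/measurable_EFinP/measurable_funM; last exact: measurable_boolR.
  apply: measurableT_comp => //; apply: measurable_funM => //.
  exact: measurable_random_total.
by rewrite lee_fin mulr_ge0 ?expR_ge0.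
Qed.

Lemma measurable_flag_integral (V : T1 * T2 * T3 -> bool) :
  measurable_fun setT V ->
  measurable_fun setT (fun w : T1 * T2 => \int[P]_w3 (V (w, w3))%:R%:E)%E.
Proof.
move=> mV.
apply: (measurable_fun_fubini_tonelli_F (m2 := P) (fun w => (V w)%:R%:E)) => [|w].
  by apply/measurable_EFinP/measurable_boolR.
by rewrite lee_fin.
Qed.

End random_chain_measurability.

(** * The exponential martingale on a grid of operational time *)

Lemma measurable_nat_natr d (T : measurableType d) (R : realType) (f : T -> nat) :
  measurable_fun setT (fun w => (f w)%:R : R) -> measurable_fun setT f.
Proof.
move=> mf _ B _; rewrite setTI.
rewrite (_ : f @^-1` B =
    (fun w => (f w)%:R : R) @^-1` (\bigcup_(k in B) [set k%:R])).
  rewrite -[X in measurable X]setTI; apply: mf => //.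
  by apply: bigcup_measurable => k _; exact: measurable_set1.
apply/seteqP; split => [w Bw|w [k Bk /= /eqP]]; first by exists (f w).
by rewrite eqr_nat => /eqP fk; rewrite /= fk.
Qed.

Section chain.
Context d (T : measurableType d) (R : realType) (P : probability T R).
Variables (mu y s u c : R) (X dN dD : nat -> T -> R).
Variables (a : nat) (n : nat -> T -> nat) (D : nat -> T -> R).
Variables (rho_z rho_s M K : R).
Hypotheses (mu_gt0 : 0 < mu) (y_gt0 : 0 < y) (y_lt1 : y < 1).
Hypotheses (u_gt0 : 0 < u) (c_gt0 : 0 < c).
Hypothesis mX : forall i, measurable_fun setT (X i).
Hypothesis X_indep : mutually_independent P X.
Hypothesis X_law : forall i B, measurable B ->
  P (X i @^-1` B) = exponential_prob mu B.
Hypothesis mdN : forall i, measurable_fun setT (dN i).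
Hypothesis dN_indep : mutually_independent P dN.
Hypothesis mdD : forall i, measurable_fun setT (dD i).
Hypothesis dD_indep : mutually_independent P dD.
(* [D j] is the subordinator and [n j] the number of claims at grid step [j],
   with increments [dD] and [dN]. The count may run [a] steps ahead of the
   subordinator: [a = 1] makes grid ruin easier than ruin, [a = 0] harder. *)
Hypothesis nE : forall j w, (n j w)%:R = \sum_(i < j + a) dN i w :> R.
Hypothesis n_nd : forall j w, (n j w <= n j.+1 w)%N.
Hypothesis DE : forall j w, D j w = \sum_(i < j) dD i w.
Hypothesis dD_ge0 : forall j w, 0 <= dD j w.
Local Notation S k w := (total_claims (X^~ w) k).
Local Notation r := (mu * (1 - y)).
Local Notation z := (s + c * r).
Hypothesis dD_z : forall i,
  (\int[P]_w (expR (- z * dD i w))%:E = rho_z%:E)%E.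
Hypothesis dD_s : forall i,
  (\int[P]_w (expR (- s * dD i w))%:E = rho_s%:E)%E.
(* [rho_z * M = 1] is the equation for [y]: the discount e^{-zD} loses in one
   step exactly what the claims gain. *)
Hypotheses (rho_s_ge0 : 0 <= rho_s) (rho_s_le1 : rho_s <= 1).
Hypotheses (rho_z_ge0 : 0 <= rho_z) (rho_z_le1 : rho_z <= 1) (rho_M : rho_z * M = 1).
Hypothesis dn_M : forall j,
  (\int[P]_w (y^-1 ^+ (n j.+1 w - n j w))%:E = M%:E)%E.
Hypothesis dn_K : forall j,
  (\int[P]_w ((1 < n j.+1 w - n j w)%N%:R * y^-1 ^+ (n j.+1 w - n j w))%:E
   <= K%:E)%E.
Local Open Scope ereal_scope.

Local Notation b j := (fun w => u + c * D j w)%R.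

(** The three coordinates of the sample point drive the counts, the subordinator
    and the claims respectively. *)
Definition chain_survives j (w : T * T * T) : bool :=
  survives_before (X^~ w.2) (n^~ w.1.1) (fun i => b i w.1.2) j.

Definition chain_ruined j (w : T * T * T) : bool :=
  ruined_at (X^~ w.2) (n^~ w.1.1) (fun i => b i w.1.2) j.

Definition chain_slice j (V : T * T * T -> bool) (w : T * T) : \bar R :=
  (expR (- z * D j w.2))%:E *
  \int[P]_w3 (expR (r * S (n j w.1) w3) * (V (w, w3))%:R)%:E.

(** The mean of the exponential martingale e^{-zD + rS} over the event [V] at
    step [j]. *)
Definition chain_weight j (V : T * T * T -> bool) : \bar R :=
  \int[P]_w1 \int[P]_w2 chain_slice j V (w1, w2).

(** The discounted probability E(e^{-sD}; first ruin at step [j]). *)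
Definition chain_ruin_mass j : \bar R :=
  \int[P]_w1 \int[P]_w2 ((expR (- s * D j w2))%:E *
     \int[P]_w3 (chain_ruined j (w1, w2, w3))%:R%:E).

Let D_nd j w : (D j w <= D j.+1 w)%R.
Proof. by rewrite !DE big_ord_recr/= lerDl. Qed.

Let b_nd j w : (b j w <= b j.+1 w)%R.
Proof. by rewrite lerD2l ler_wpM2l// ltW. Qed.

Let b0 w : (0 <= b 0%N w)%R.
Proof. by rewrite /= DE big_ord0 mulr0 addr0 ltW. Qed.

Let dNE j w : dN (j + a)%N w = (n j.+1 w - n j w)%:R.
Proof. by rewrite natrB// !nE addSn big_ord_recr/= addrAC subrr add0r. Qed.

Let measurable_sum_past (xi : nat -> T -> R) j k : (j <= k)%N ->
  measurable_fun setT (fun w : past xi k => \sum_(i < j) xi i w)%R.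
Proof. exact: measurable_past_total. Qed.

Let mn_past j k : (j <= k)%N ->
  measurable_fun setT (n j : past dN (k + a) -> nat).
Proof.
move=> jk; apply: (@measurable_nat_natr _ _ R).
under eq_fun do rewrite nE.
by apply: measurable_sum_past; rewrite leq_add2r.
Qed.

Let mn j : measurable_fun setT (n j).
Proof.
exact: (measurableT_comp (mn_past (leqnn j)) (measurable_to_past mdN (n := j + a))).
Qed.

Let mD_past j k : (j <= k)%N ->
  measurable_fun setT (D j : past dD k -> R).
Proof.
move=> jk; have -> : D j = (fun w => \sum_(i < j) dD i w)%R.
  by apply/funext => w; exact: DE.
exact: measurable_sum_past.
Qed.

Let mD j : measurable_fun setT (D j).
Proof.
exact: (measurableT_comp (mD_past (leqnn j)) (measurable_to_past mdD (n := j))).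
Qed.

Let mb_of d' (T' : measurableType d') (D' : T' -> R) :
  measurable_fun setT D' -> measurable_fun setT (fun w => u + c * D' w)%R.
Proof. by move=> mD'; apply: measurable_funD => //; exact: measurable_funM. Qed.

Let msurv j : measurable_fun setT (chain_survives j).
Proof.
by apply: (measurable_random_survives (J := j) (n := n) (b := fun j => b j)) => // i _;
  exact: mb_of.
Qed.

Let mruin j : measurable_fun setT (chain_ruined j).
Proof.
by apply: (measurable_random_ruined (J := j) (n := n) (b := fun j => b j)) => // i _;
  exact: mb_of.
Qed.

Let mexpD d' (T' : measurableType d') d'' (T'' : measurableType d'') (D' : T'' -> R) q :
  measurable_fun setT D' ->
  measurable_fun setT (fun w : T' * T'' => (expR (- q * D' w.2))%:E).
Proof.
move=> mD'; apply/measurable_EFinP; apply: measurableT_comp => //.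
by apply: measurable_funM => //; exact: measurableT_comp.
Qed.

Let slice_ge0 j V w : 0 <= chain_slice j V w.
Proof.
rewrite mule_ge0 ?lee_fin ?expR_ge0//; apply: integral_ge0 => w3 _.
by rewrite lee_fin mulr_ge0 ?expR_ge0.
Qed.

Let slice_int_ge0 j V w1 : 0 <= \int[P]_w2 chain_slice j V (w1, w2).
Proof. by apply: integral_ge0. Qed.

Let mslice j V : measurable_fun setT V -> measurable_fun setT (chain_slice j V).
Proof.
move=> mV; apply: emeasurable_funM; first exact: mexpD.
exact: measurable_weight_integral.
Qed.

Let mslice2 j V w1 : measurable_fun setT V ->
  measurable_fun setT (fun w2 : T => chain_slice j V (w1, w2)).
Proof. by move=> mV; exact: (measurableT_comp (mslice j mV) (pair1_measurable w1)). Qed.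

Let mslice1 j V : measurable_fun setT V ->
  measurable_fun setT (fun w1 : T => \int[P]_w2 chain_slice j V (w1, w2)).
Proof.
by move=> mV; exact: (measurable_fun_fubini_tonelli_F (m2 := P) _ (mslice j mV)).
Qed.

Let flag_ge0 (V : T * T * T -> bool) w : 0 <= \int[P]_w3 (V (w, w3))%:R%:E.
Proof. by apply: integral_ge0 => w3 _; rewrite lee_fin. Qed.

Let mass_ge0 j w : 0 <= (expR (- s * D j w.2))%:E *
  \int[P]_w3 (chain_ruined j (w, w3))%:R%:E.
Proof. by rewrite mule_ge0 ?lee_fin ?expR_ge0. Qed.

Let mmass j : measurable_fun setT (fun w : T * T => (expR (- s * D j w.2))%:E *
  \int[P]_w3 (chain_ruined j (w, w3))%:R%:E).
Proof.
apply: emeasurable_funM; first exact: mexpD.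
exact: measurable_flag_integral.
Qed.

Let mmass2 j w1 : measurable_fun setT (fun w2 : T => (expR (- s * D j w2))%:E *
  \int[P]_w3 (chain_ruined j (w1, w2, w3))%:R%:E).
Proof. exact: (measurableT_comp (mmass j) (pair1_measurable w1)). Qed.

Let mmass1 j : measurable_fun setT (fun w1 : T => \int[P]_w2
  ((expR (- s * D j w2))%:E * \int[P]_w3 (chain_ruined j (w1, w2, w3))%:R%:E)).
Proof. exact: (measurable_fun_fubini_tonelli_F (m2 := P) _ (mmass j)). Qed.

Lemma chain_split j : chain_weight j (chain_survives j) =
  chain_weight j (chain_survives j.+1) + chain_weight j (chain_ruined j).
Proof.
rewrite /chain_weight -ge0_integralD//; [|exact: mslice1..].
apply: eq_integral => w1 _; rewrite -ge0_integralD//; [|exact: mslice2..].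
apply: eq_integral => w2 _; rewrite -ge0_muleDr; last 2 first.
- by apply: integral_ge0 => w3 _; rewrite lee_fin mulr_ge0 ?expR_ge0.
- by apply: integral_ge0 => w3 _; rewrite lee_fin mulr_ge0 ?expR_ge0.
congr *%E; exact: (weight_split P mu y mX (n := n^~ w1)
  (fun i => b i w2) (fun i => n_nd i w1)).
Qed.

(* As z = s + c r, the weight at the barrier b = u + c D is e^{ru} e^{-sD}. *)
Let discount j w2 : (expR (- z * D j w2) * expR (r * b j w2) =
  expR (r * u) * expR (- s * D j w2))%R.
Proof. by rewrite -!expRD; congr expR; ring. Qed.

Let ru0 : (0 <= y^-1 * expR (r * u))%R.
Proof. by rewrite mulr_ge0 ?expR_ge0// invr_ge0 ltW. Qed.

Lemma chain_ruin_ge j :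
  (y^-1 * expR (r * u))%:E * chain_ruin_mass j <= chain_weight j (chain_ruined j).
Proof.
rewrite /chain_ruin_mass -ge0_integralZl//; last first.
  by move=> w1 _; apply: integral_ge0 => w2 _; exact: (mass_ge0 j (w1, w2)).
apply: ge0_le_integral => //.
- move=> w1 _; rewrite mule_ge0 ?lee_fin//.
  by apply: integral_ge0 => w2 _; exact: (mass_ge0 j (w1, w2)).
- by apply: emeasurable_funM.
- exact: mslice1.
move=> w1 _; rewrite -ge0_integralZl//; last first.
  by move=> w2 _; exact: (mass_ge0 j (w1, w2)).
apply: ge0_le_integral => //.
- by move=> w2 _; rewrite mule_ge0 ?lee_fin//; exact: (mass_ge0 j (w1, w2)).
- by apply: emeasurable_funM.
- exact: mslice2.
move=> w2 _; rewrite muleA -EFinM -(mulrA (y^-1)%R) -discount mulrCA EFinM -muleA.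
rewrite lee_wpmul2l ?lee_fin ?expR_ge0//.
exact: (first_ruin_weight_ge mu_gt0 y_gt0 y_lt1 mX X_indep X_law
  (n := n^~ w1) (b := fun i => b i w2) (fun i => n_nd i w1)
  (fun i => b_nd i w2) (b0 w2)).
Qed.

(** The increments of both processes over the next step are independent of
    everything known at step [j]; integrating them out gives [rho_z] and a
    moment of the number of claims in the step. *)
Lemma chain_step j (phi : R -> R) : measurable_fun setT phi ->
  (forall x, (0 <= phi x)%R) ->
  \int[P]_w1 \int[P]_w2 ((phi (dN (j + a)%N w1))%:E * ((expR (- z * D j.+1 w2))%:E *
     \int[P]_w3 (expR (r * S (n j w1) w3) *
        (chain_survives j.+1 (w1, w2, w3))%:R)%:E)) =
  (rho_z%:E * \int[P]_w (phi (dN (j + a)%N w))%:E) *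
    chain_weight j (chain_survives j.+1).
Proof.
move=> mphi phi0.
have mg2 w1 : measurable_fun setT (fun w2 : past dD j =>
    chain_slice j (chain_survives j.+1) (w1, w2)).
  apply: (measurableT_comp (f := fun w : T * past dD j =>
    chain_slice j (chain_survives j.+1) w) _ (pair1_measurable w1)).
  apply: emeasurable_funM; first by apply: mexpD; exact: mD_past.
  apply: measurable_weight_integral => //.
  apply: (measurable_random_survives (T1 := T) (T2 := past dD j)
    (J := j) (n := n) (b := fun i => b i)) => //.
  by move=> i ij; apply: mb_of; exact: mD_past.
have mg1 : measurable_fun setT (fun w1 : past dN (j + a) =>
    \int[P]_w2 chain_slice j (chain_survives j.+1) (w1, w2)).
  apply: (measurable_fun_fubini_tonelli_F (m2 := P)
    (fun w : past dN (j + a) * T => chain_slice j (chain_survives j.+1) w)) => //.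
  apply: emeasurable_funM; first exact: mexpD.
  have mnj := mn_past (leqnn j).
  apply: (measurable_weight_integral (T1 := past dN (j + a)) (T2 := T) P mX r mnj).
  apply: (measurable_random_survives (T1 := past dN (j + a)) (T2 := T)
    (J := j) (n := n) (b := fun i => b i)) => //.
  - by move=> i ij; exact: mn_past.
  - by move=> i _; exact: mb_of.
transitivity (\int[P]_w1 (rho_z%:E *
    (\int[P]_w2 chain_slice j (chain_survives j.+1) (w1, w2) *
     (phi (dN (j + a)%N w1))%:E))).
  apply: eq_integral => w1 _.
  transitivity (\int[P]_w2 (chain_slice j (chain_survives j.+1) (w1, w2) *
      (phi (dN (j + a)%N w1) * expR (- z * dD j w2))%:E)).
    apply: eq_integral => w2 _; rewrite /chain_slice /= EFinM [RHS]muleC -!muleA.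
    congr *%E; rewrite muleA -EFinM; congr (_ * _); congr (_%:E).
    by rewrite -expRD !DE big_ord_recr/= mulrDr addrC.
  rewrite (integral_past_prod (xi := dD) mdD dD_indep
    (f := fun x => (phi (dN (j + a)%N w1) * expR (- z * x))%:E) (mg2 w1)); last 3 first.
  - by move=> w; exact: slice_ge0.
  - apply/measurable_EFinP/measurable_funM => //.
    by apply: measurableT_comp => //; exact: mulrl_measurable.
  - by move=> x; rewrite lee_fin mulr_ge0 ?expR_ge0.
  under [X in _ * X]eq_integral do rewrite EFinM.
  rewrite ge0_integralZl//; last 2 first.
  - apply/measurable_EFinP; apply: measurableT_comp => //.
    by apply: measurable_funM.
  - by rewrite lee_fin.
  by rewrite dD_z muleA muleC.
rewrite ge0_integralZl//; last 2 first.
- apply: emeasurable_funM; first exact: mslice1.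
  by apply/measurable_EFinP; exact: measurableT_comp.
- by move=> w1 _; rewrite mule_ge0 ?lee_fin.
rewrite -muleA; congr *%E.
rewrite (integral_past_prod (xi := dN) mdN dN_indep
    (f := fun x => (phi x)%:E) mg1); last 3 first.
- by move=> w; exact: slice_int_ge0.
- exact/measurable_EFinP.
- by move=> x; rewrite lee_fin.
by rewrite muleC.
Qed.

Let yV_ge0 : (0 <= y^-1)%R. Proof. by rewrite invr_ge0 ltW. Qed.

Let natpowE k : (y^-1 ^+ k)%R = (y^-1 `^ k%:R)%R.
Proof. by rewrite powR_mulrn. Qed.

Let slice_next j w1 w2 :
  chain_slice j.+1 (chain_survives j.+1) (w1, w2) =
  (y^-1 ^+ (n j.+1 w1 - n j w1))%:E * ((expR (- z * D j.+1 w2))%:E *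
     \int[P]_w3 (expR (r * S (n j w1) w3) *
        (chain_survives j.+1 (w1, w2, w3))%:R)%:E).
Proof.
rewrite muleCA; congr *%E.
exact: (weight_next_step mu_gt0 y_gt0 mX X_indep X_law
  (n := n^~ w1) (fun i => b i w2) (fun i => n_nd i w1)).
Qed.

(** The martingale property, from [rho_z * M = 1]. *)
Lemma chain_next j :
  chain_weight j.+1 (chain_survives j.+1) = chain_weight j (chain_survives j.+1).
Proof.
transitivity ((rho_z%:E * \int[P]_w (y^-1 `^ dN (j + a)%N w)%:E) *
    chain_weight j (chain_survives j.+1)); last first.
  rewrite (_ : \int[P]_w _ = M%:E); first by rewrite -EFinM rho_M mul1e.
  by rewrite -(dn_M j); apply: eq_integral => w _; rewrite dNE natpowE.
have mpow : measurable_fun setT (fun x : R => y^-1 `^ x)%R.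
  exact: measurable_powRr.
have pow0 (x : R) : (0 <= y^-1 `^ x)%R by exact: powR_ge0.
rewrite -(chain_step j mpow pow0).
apply: eq_integral => w1 _; apply: eq_integral => w2 _.
by rewrite slice_next dNE natpowE.
Qed.

Lemma chain_ruin_le j : chain_weight j.+1 (chain_ruined j.+1) <=
  (y^-1 * expR (r * u))%:E * chain_ruin_mass j.+1 +
  K%:E * chain_weight j (chain_survives j.+1).
Proof.
pose phi x := ((1 < x)%R%:R * y^-1 `^ x)%R.
have mphi : measurable_fun setT phi.
  apply: measurable_funM; last exact: measurable_powRr.
  by apply: measurable_boolR; exact: measurable_fun_ltr.
have phi0 x : (0 <= phi x)%R by rewrite mulr_ge0 ?powR_ge0.
have phiE w : phi (dN (j + a)%N w) = ((1 < n j.+1 w - n j w)%N%:R *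
    y^-1 ^+ (n j.+1 w - n j w))%R.
  by rewrite /phi dNE natpowE ltr1n.
set double := \int[P]_w1 \int[P]_w2 ((phi (dN (j + a)%N w1))%:E *
     ((expR (- z * D j.+1 w2))%:E *
     \int[P]_w3 (expR (r * S (n j w1) w3) *
        (chain_survives j.+1 (w1, w2, w3))%:R)%:E)).
have double_le : double <= K%:E * chain_weight j (chain_survives j.+1).
  rewrite /double (chain_step j mphi phi0); apply: lee_wpmul2r.
    by apply: integral_ge0.
  have phi_le : \int[P]_w (phi (dN (j + a)%N w))%:E <= K%:E.
    by rewrite (le_trans _ (dn_K j))//; under eq_integral do rewrite phiE.
  rewrite (le_trans _ phi_le)// -[leRHS]mul1e lee_wpmul2r ?lee_fin//.
  by apply: integral_ge0 => w _; rewrite lee_fin.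
apply: le_trans (leeD2l _ double_le).
pose G (w : T * T) : \bar R := (phi (dN (j + a)%N w.1))%:E *
  ((expR (- z * D j.+1 w.2))%:E * \int[P]_w3 (expR (r * S (n j w.1) w3) *
        (chain_survives j.+1 (w, w3))%:R)%:E).
have mG : measurable_fun setT G.
  apply: emeasurable_funM.
    apply/measurable_EFinP; apply: (measurableT_comp mphi).
    exact: measurableT_comp.
  apply: emeasurable_funM; first exact: mexpD.
  exact: measurable_weight_integral.
have G0 w : 0 <= G w.
  rewrite !mule_ge0 ?lee_fin ?expR_ge0//; apply: integral_ge0 => w3 _.
  by rewrite lee_fin mulr_ge0 ?expR_ge0.
have mG1 w1 : measurable_fun setT (fun w2 => G (w1, w2)).
  exact: (measurableT_comp mG (pair1_measurable w1)).
have doubleE : double = \int[P]_w1 \int[P]_w2 G (w1, w2) by [].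
rewrite doubleE /chain_ruin_mass -ge0_integralZl//; last first.
  by move=> w1 _; apply: integral_ge0 => w2 _; exact: (mass_ge0 j.+1 (w1, w2)).
have mass_int_ge0 w1 : 0 <= \int[P]_w2 ((expR (- s * D j.+1 w2))%:E *
    \int[P]_w3 (chain_ruined j.+1 (w1, w2, w3))%:R%:E).
  by apply: integral_ge0 => w2 _; exact: (mass_ge0 j.+1 (w1, w2)).
rewrite -ge0_integralD//; last 4 first.
- by move=> w1 _; rewrite mule_ge0 ?lee_fin.
- by apply: emeasurable_funM.
- by move=> w1 _; apply: integral_ge0.
- exact: (measurable_fun_fubini_tonelli_F (m2 := P) _ mG).
apply: ge0_le_integral => //.
- exact: mslice1.
- apply: emeasurable_funD; first by apply: emeasurable_funM.
  exact: (measurable_fun_fubini_tonelli_F (m2 := P) _ mG).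
move=> w1 _; rewrite -ge0_integralZl//; last first.
  by move=> w2 _; exact: (mass_ge0 j.+1 (w1, w2)).
rewrite -ge0_integralD//; last 2 first.
- by move=> w2 _; rewrite mule_ge0 ?lee_fin//; exact: (mass_ge0 j.+1 (w1, w2)).
- by apply: emeasurable_funM.
apply: ge0_le_integral => //.
- exact: mslice2.
- by apply: emeasurable_funD => //; apply: emeasurable_funM.
move=> w2 _; rewrite muleA -EFinM -(mulrA (y^-1)%R) -discount mulrCA EFinM -muleA.
have -> : G (w1, w2) = (1 < n j.+1 w1 - n j w1)%N%:R%:E *
    chain_slice j.+1 (chain_survives j.+1) (w1, w2).
  by rewrite slice_next muleA /G/= phiE EFinM.
rewrite /chain_slice /= [X in _ <= _ + X]muleCA.
rewrite -ge0_muleDr; last 2 first.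
- by rewrite mule_ge0 ?lee_fin ?mulr_ge0 ?expR_ge0//; exact: (flag_ge0 (chain_ruined j.+1)).
- rewrite mule_ge0 ?lee_fin//; apply: integral_ge0 => w3 _.
  by rewrite lee_fin mulr_ge0 ?expR_ge0.
rewrite lee_wpmul2l ?lee_fin ?expR_ge0//.
exact: (first_ruin_weight_le mu_gt0 y_gt0 mX X_indep X_law
  (n := n^~ w1) (b := fun i => b i w2) (fun i => n_nd i w1)
  (fun i => b_nd i w2) (b0 w2)).
Qed.

(** While there is no ruin S is at most u + c D, so the weight is at most
    e^{ru} e^{-sD}, and the mean of e^{-sD} decays geometrically. *)
Lemma chain_alive_le j :
  chain_weight j (chain_survives j.+1) <= (expR (r * u) * rho_s ^+ j)%:E.
Proof.
have DsE : \int[P]_w (expR (- s * D j w))%:E = (rho_s ^+ j)%:E.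
  elim: j => [|j IH].
    under eq_integral do rewrite DE big_ord0 mulr0 expR0.
    by rewrite probability_integral_cst.
  transitivity (\int[P]_w ((expR (- s * D j w))%:E * (expR (- s * dD j w))%:E)).
    apply: eq_integral => w _.
    by rewrite -EFinM -expRD !DE big_ord_recr/= -mulrDr.
  rewrite (integral_past_prod (xi := dD) (n := j) mdD dD_indep
      (g := fun w => (expR (- s * D j w))%:E)
      (f := fun x => (expR (- s * x))%:E)).
  - by rewrite IH dD_s -EFinM exprSr.
  - apply/measurable_EFinP; apply: measurableT_comp => //.
    by apply: measurable_funM => //; exact: mD_past.
  - by move=> w; rewrite lee_fin expR_ge0.
  - by apply/measurable_EFinP; apply: measurableT_comp => //; exact: mulrl_measurable.
  - by move=> x; rewrite lee_fin expR_ge0.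
rewrite EFinM -DsE -[leRHS](probability_integral_cst P).
have mDs : measurable_fun setT (fun w : T => (expR (- s * D j w))%:E).
  apply/measurable_EFinP; apply: measurableT_comp => //.
  exact: measurable_funM.
apply: ge0_le_integral => //; first exact: mslice1.
move=> w1 _; rewrite -ge0_integralZl// ?lee_fin ?expR_ge0//.
apply: ge0_le_integral => //.
- exact: mslice2.
- by apply: emeasurable_funM.
move=> w2 _; rewrite -EFinM -discount EFinM lee_wpmul2l ?lee_fin ?expR_ge0//.
exact: (survival_weight_le P mu_gt0 y_lt1 mX (n := n^~ w1)
  (fun i => b i w2) (fun i => n_nd i w1)).
Qed.

Lemma chain_start : chain_weight 0 (chain_survives 0) =
  \int[P]_w (y^-1 ^+ n 0%N w)%:E.
Proof.
apply: eq_integral => w1 _; rewrite -[RHS](probability_integral_cst P).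
apply: eq_integral => w2 _; rewrite /chain_slice DE big_ord0 mulr0 expR0 mul1e.
under eq_integral do rewrite mulr1.
exact: (weight_at_start mu_gt0 y_gt0 mX X_indep X_law (n^~ w1)).
Qed.

Let mass_int_ge0 j : 0 <= chain_ruin_mass j.
Proof.
apply: integral_ge0 => w1 _; apply: integral_ge0 => w2 _.
exact: (mass_ge0 j (w1, w2)).
Qed.

Let weight_ge0 j V : 0 <= chain_weight j V.
Proof. by apply: integral_ge0. Qed.

(** Optional stopping: the initial weight equals the weight spent at ruin during
    the first [J] steps plus the weight still alive, and the latter is
    nonnegative. *)
Lemma chain_total_ruin_mass_le J :
  (y^-1 * expR (r * u))%:E * \sum_(j < J) chain_ruin_mass j <=
  \int[P]_w (y^-1 ^+ n 0%N w)%:E.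
Proof.
suff : (y^-1 * expR (r * u))%:E * \sum_(j < J) chain_ruin_mass j +
    chain_weight J (chain_survives J) <= chain_weight 0 (chain_survives 0).
  by rewrite chain_start; apply: le_trans; rewrite leeDl.
elim: J => [|J IH]; first by rewrite big_ord0 mule0 add0e.
apply: le_trans IH; rewrite big_ord_recr/=.
rewrite ge0_muleDr; [|exact: sume_ge0|exact: mass_int_ge0].
rewrite -addeA; apply: leeD2l; rewrite (chain_split J) chain_next addeC.
by apply: leeD2l; exact: chain_ruin_ge.
Qed.

(** Optional stopping in the other direction: the weight still alive is bounded
    by [chain_alive_le], and each step loses at most a multiple of [K] because
    of double claims. *)
Lemma chain_total_ruin_mass_ge J : (forall w, n 0%N w = 0%N) ->
  1 <= (y^-1 * expR (r * u))%:E * \sum_(j < J.+1) chain_ruin_mass j +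
       (expR (r * u) * (rho_s ^+ J + J%:R * K))%:E.
Proof.
move=> n0; set E := expR (r * u).
have E0 : (0 <= E)%R by exact: expR_ge0.
have start : chain_weight 0 (chain_survives 0) = 1.
  rewrite chain_start; under eq_integral do rewrite n0 expr0.
  exact: probability_integral_cst.
suff step : 1 <= (y^-1 * E)%:E * \sum_(j < J.+1) chain_ruin_mass j +
    (E * (J%:R * K))%:E + chain_weight J (chain_survives J.+1).
  apply: (le_trans step); rewrite mulrDr EFinD [X in _ <= _ + X]addeC addeA.
  by apply: leeD2l; exact: chain_alive_le.
have K0 : (0 <= K)%R.
  rewrite -lee_fin; apply: le_trans (dn_K 0); apply: integral_ge0 => w _.
  by rewrite lee_fin mulr_ge0// exprn_ge0.
elim: J => [|J IH].
  have ruin0 : chain_weight 0 (chain_ruined 0) = 0.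
    apply: integral0_eq => w1 _; apply: integral0_eq => w2 _.
    rewrite /chain_slice integral0_eq ?mule0// => w3 _.
    rewrite /chain_ruined /ruined_at /= n0 /total_claims big_ord0 ltNge.
    by rewrite (b0 w2) mulr0.
  rewrite -start chain_split ruin0 adde0 leeDr// adde_ge0//.
    by rewrite mule_ge0 ?lee_fin// sume_ge0.
  by rewrite lee_fin mulr_ge0 ?mul0r.
apply: (le_trans IH); rewrite [X in _ <= _ * X + _ + _]big_ord_recr/=.
rewrite ge0_muleDr; [|exact: sume_ge0|exact: mass_int_ge0].
have alive : K%:E * chain_weight J (chain_survives J.+1) <= (E * K)%:E.
  rewrite mulrC EFinM; apply: lee_wpmul2l; first by rewrite lee_fin.
  apply: (le_trans (chain_alive_le J)); rewrite lee_fin ler_piMr//.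
  exact: exprn_ile1.
have ruin : chain_weight J.+1 (chain_ruined J.+1) <=
    (y^-1 * E)%:E * chain_ruin_mass J.+1 + (E * K)%:E.
  by apply: (le_trans (chain_ruin_le J)); exact: leeD2l.
rewrite -chain_next chain_split; move: ruin.
move: (chain_weight _ (chain_ruined _)) (chain_weight _ (chain_survives J.+2)).
move: (_ * (\sum_(i < J.+1) _)) (_ * chain_ruin_mass _) => A m V W ruin.
rewrite -natr1 mulrDl mul1r mulrDr EFinD -!addeA; apply: leeD2l.
rewrite [leRHS]addeCA; apply: leeD2l; rewrite [leLHS]addeC addeA.
exact: leeD2r.
Qed.

End chain.

(** * Laplace transform of a random time *)

Section laplace_of_random_time.
Context d (T : measurableType d) (R : realType).
Variables (Q : {sigma_finite_measure set T -> \bar R}) (B : set T) (tau : T -> R).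
Hypotheses (mB : measurable B) (mtau : measurable_fun setT tau).
Hypothesis tau_ge0 : forall w, 0 <= tau w.
Local Notation leb := (@lebesgue_measure R).
Local Open Scope ereal_scope.

Lemma measurable_before (t : R) : measurable (B `&` [set w | (tau w <= t)%R]).
Proof.
apply: measurableI => //; rewrite -[X in measurable X]setTI.
rewrite (_ : [set w | _] = (fun w => (tau w <= t)%R) @^-1` [set true])//.
exact: measurable_fun_ler.
Qed.

(** Tonelli, and the integral of e^{-st} over t >= tau is e^{-s tau} / s. *)
Lemma laplace_random_time (s : R) : (0 < s)%R ->
  laplace_transform (fun t => Q (B `&` [set w | (tau w <= t)%R])) s =
  (s^-1)%:E * \int[Q]_w ((expR (- s * tau w))%:E * (\1_B w)%:E).
Proof.
move=> s0; rewrite /laplace_transform.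
pose h (z : R * T) : \bar R :=
  (expR (- s * z.1) * ((0 <= z.1) && (tau z.2 <= z.1))%R%:R * \1_B z.2)%:E.
have mh : measurable_fun setT h.
  apply/measurable_EFinP/measurable_funM.
    apply: measurable_funM.
      by apply: measurableT_comp => //; exact: measurable_funM.
    apply/measurable_boolR/measurable_and; first exact: measurable_fun_ler.
    apply: measurable_fun_ler; last exact: measurable_fst.
    exact: measurableT_comp.
  by apply: measurableT_comp; [exact: measurable_indic|exact: measurable_snd].
have h0 z : 0 <= h z by rewrite lee_fin !mulr_ge0 ?expR_ge0.
transitivity (\int[leb]_t \int[Q]_w h (t, w)).
  rewrite integral_mkcond; apply: eq_integral => t _.
  rewrite patchE mem_setE in_itv/= andbT; case: ifPn => t0.
    rewrite (measureE_integral_indic Q (measurable_before t)) -ge0_integralZl//; last first.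
      apply/measurable_EFinP; apply: measurable_indic; exact: measurable_before.
    apply: eq_integral => w _; rewrite /h /= t0 -EFinM -mulrA; congr (_ * _)%:E.
    rewrite indicI/= mulrC; congr *%R; rewrite indicE; congr (_%:R); congr nat_of_bool.
    by apply/idP/idP; rewrite in_setE.
  by rewrite integral0_eq// => w _; rewrite /h /= (negbTE t0) mulr0 mul0r.
rewrite (@fubini_tonelli _ _ _ _ _ leb Q h mh h0).
rewrite -ge0_integralZl//; last 2 first.
- apply: emeasurable_funM; last by apply/measurable_EFinP; exact: measurable_indic.
  by apply/measurable_EFinP; apply: measurableT_comp => //; exact: measurable_funM.
- by rewrite lee_fin invr_ge0 ltW.
apply: eq_integral => w _.
transitivity ((s^-1 * \1_B w)%:E *
    \int[leb]_(t in `[tau w, +oo[) (s * expR (- s * t))%:E); last first.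
  by rewrite integral_expR_tail// -!EFinM; congr _%:E; rewrite mulrAC mulrA.
rewrite -ge0_integralZl//; last 3 first.
- exact: measurable_MexpNM.
- by move=> t _; rewrite lee_fin mulr_ge0 ?expR_ge0// ltW.
- by rewrite lee_fin mulr_ge0// invr_ge0 ltW.
rewrite [RHS]integral_mkcond; apply: eq_integral => t _.
rewrite patchE mem_setE in_itv/= andbT /h/=; case: (leP (tau w) t) => wt.
  rewrite (le_trans (tau_ge0 w) wt) mulr1 -EFinM; congr _%:E.
  by rewrite mulrACA mulVf ?gt_eqF// mul1r mulrC.
by rewrite andbF mulr0 mul0r.
Qed.

End laplace_of_random_time.

(** * Ruin in calendar time and ruin on the grid *)

Section first_passage.
Context {R : realType}.
Variable f : R -> R.
Local Notation Y t := (inf [set s : R | 0 <= s /\ t < f s]).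

Let passage_lb t : has_lbound [set s | 0 <= s /\ t < f s].
Proof. by exists 0 => s []. Qed.

Lemma first_passage_ge0 t : 0 <= Y t.
Proof.
have [->|/set0P ne] := eqVneq [set s | 0 <= s /\ t < f s] set0.
  by rewrite inf0.
by apply: lb_le_inf => // s [].
Qed.

Lemma first_passage_le t s : 0 <= s -> t < f s -> Y t <= s.
Proof. by move=> s0 ts; apply: ge_inf. Qed.

(** In the first alternative [Y t] is the default value 0 of [inf]. *)
Lemma first_passage_ltP t a : Y t < a ->
  [set s | 0 <= s /\ t < f s] = set0 \/ exists s, [/\ 0 <= s, t < f s & s < a].
Proof.
have [->|/set0P ne] := eqVneq [set s | 0 <= s /\ t < f s] set0; first by left.
by move=> /(inf_lt ne)[s [s0 ts] sa]; right; exists s.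
Qed.

Lemma first_passage_right t e : 0 < e -> exists2 d, 0 < d &
  forall t', t <= t' < t + d -> Y t <= Y t' < Y t + e.
Proof.
move=> e0; have : Y t < Y t + e by rewrite ltrDl.
case/first_passage_ltP => [E0|[s [s0 ts se]]].
  exists 1 => // t' /andP[tt' _].
  rewrite (_ : [set s | 0 <= s /\ t' < f s] = set0); first by rewrite E0 inf0 lexx add0r.
  apply/seteqP; split => // s [s0 /(le_lt_trans tt') ts].
  by have : [set s | 0 <= s /\ t < f s] s by []; rewrite E0.
exists (f s - t); first by rewrite subr_gt0.
move=> t' /andP[tt']; rewrite subrKC => t's; apply/andP; split.
  apply: lb_le_inf; first by exists s.
  by move=> s' [s'0 t's']; apply: first_passage_le => //; exact: le_lt_trans t's'.
by apply: le_lt_trans se; exact: first_passage_le.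
Qed.

End first_passage.

Lemma right_continuous_nat_const (R : realType) (N : R -> nat) (t : R) :
  (N s)%:R @[s --> t^'+] --> ((N t)%:R : R) ->
  exists2 e : R, 0 < e & forall t', t <= t' < t + e -> N t' = N t.
Proof.
move=> /cvgrPdist_lt /(_ 1 ltr01) /nbhs_ballP[e /= e0 He].
exists e => // t' /andP[]; rewrite le_eqVlt => /orP[/eqP->//|tt'] t'e.
have /He : ball t e t'.
  by rewrite /ball/= distrC ger0_norm ?subr_ge0 ?(ltW tt')// ltrBlDl.
move=> /(_ tt'); rewrite -[X in X < _]/(`|(N t)%:R - (N t')%:R|).
case: (leqP (N t) (N t')) => NN.
  rewrite distrC -natrB// normr_nat -[1]/(1%:R) ltr_nat ltnS leqn0 subn_eq0.
  by move=> NN'; apply/eqP; rewrite eqn_leq NN' NN.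
rewrite -natrB ?(ltnW NN)// normr_nat -[1]/(1%:R) ltr_nat ltnS leqn0 subn_eq0.
by rewrite leqNgt NN.
Qed.

Section ruin_time_rational.
Context {R : realType}.
Variables (g : R -> R) (t : R).
Local Notation T := (ereal_inf [set t%:E | t in [set t | 0 < t /\ g t < 0]]).
Hypothesis g_right : forall t : R, 0 < t -> g t < 0 ->
  exists2 e, 0 < e & forall t', t <= t' < t + e -> g t' < 0.

(** By right continuity each ruin instant has rational ruin instants just after
    it, so ruin before [t] is decided on countably many instants. *)
Lemma ruin_time_le_ratP :
  (T <= t%:E)%E <->
  forall k : nat, exists q : rat,
    [/\ 0 < ratr q :> R, ratr q < t + k.+1%:R^-1 & g (ratr q) < 0].
Proof.
split=> [gt k|gt].
  have : (T < (t + k.+1%:R^-1)%:E)%E.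
    by apply: le_lt_trans gt _; rewrite lte_fin ltrDl invr_gt0.
  case/ereal_inf_lt => _ [t' [t'0 gt'] <-]; rewrite lte_fin => t'k.
  have [e e0 He] := g_right t'0 gt'.
  have : t' < Num.min (t' + e) (t + k.+1%:R^-1).
    by rewrite lt_min t'k ltrDl e0.
  move=> /rat_in_itvoo[q]; rewrite in_itv/= lt_min => /andP[t'q /andP[qe qk]].
  exists q; split => //; first exact: lt_trans t'q.
  by apply: He; rewrite (ltW t'q).
apply/lee_addgt0Pr => e e0.
have [k ke] : exists k : nat, k.+1%:R^-1 < e.
  exists (Num.truncn e^-1).
  rewrite -[ltRHS]invrK ltf_pV2 ?posrE ?invr_gt0//.
  exact: truncnS_gt.
have [q [q0 qk gq]] := gt k.
apply: (@le_trans _ _ (ratr q)%:E); first by apply: ereal_inf_lbound; exists (ratr q).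
by rewrite -EFinD lee_fin (le_trans (ltW qk))// lerD2l ltW.
Qed.

End ruin_time_rational.

Section grid_ruin.
Context {R : realType}.
Variables (u c h : R) (N : R -> nat) (f : R -> R) (x : nat -> R).
Hypotheses (u_gt0 : 0 < u) (c_gt0 : 0 < c) (h_gt0 : 0 < h).
Hypothesis N_nd : forall s t, 0 <= s -> s <= t -> (N s <= N t)%N.
Hypothesis f_nd : forall s t, 0 <= s -> s <= t -> f s <= f t.
Hypothesis x_ge0 : forall i, 0 <= x i.
Local Notation Y t := (inf [set s : R | 0 <= s /\ t < f s]).
Local Notation g t := (u + c * t - total_claims x (N (Y t))).
Local Notation T := (ereal_inf [set t%:E | t in [set t | 0 < t /\ g t < 0]]).
Local Notation b j := (u + c * f (j%:R * h)).

Let total_nd i j : (i <= j)%N -> total_claims x i <= total_claims x j.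
Proof.
move=> ij; rewrite /total_claims -(subnKC ij) big_split_ord/= lerDl.
by apply: sumr_ge0.
Qed.

Lemma survives_beforeP (n : nat -> nat) (b' : nat -> R) j :
  reflect (forall i, (i < j)%N -> total_claims x (n i) <= b' i)
    (survives_before x n b' j).
Proof.
elim: j => [|j IH] /=; first exact: ReflectT.
apply: (iffP andP) => [[Sj /IH Sij] i|S].
  by rewrite ltnS leq_eqVlt => /orP[/eqP->//|/Sij].
by split; [exact: S|apply/IH => i ij; apply: S; exact: ltnW].
Qed.

(** Immediately after the calendar time [f (j h)] the operational time has
    passed [j h], so the claims counted at [j h] have all been paid while the
    premium has hardly grown. Unboundedness of [f] makes the infimum defining
    [Y] one over a nonempty set. *)
Lemma grid_ruin_ruin j : 0 <= f 0 -> (forall K, exists2 s, 0 <= s & K < f s) ->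
  ruined_at x (fun j => N (j%:R * h)) (fun j => b j) j ->
  (T <= (f (j%:R * h))%:E)%E.
Proof.
move=> f0 f_unbounded /andP[_]; set s := j%:R * h; set S := total_claims x _ => bS.
have s0 : 0 <= s by rewrite mulr_ge0// ltW.
have fs0 : 0 <= f s by rewrite (le_trans f0)// f_nd.
apply/lee_addgt0Pr => e e0.
pose e1 := Num.min e ((S - (u + c * f s)) / (2 * c)).
have d0 : 0 < (S - (u + c * f s)) / (2 * c) by rewrite divr_gt0 ?subr_gt0 ?mulr_gt0.
have e10 : 0 < e1 by rewrite lt_min e0.
apply: (@le_trans _ _ (f s + e1)%:E); last first.
  by rewrite -EFinD lee_fin lerD2l ge_min lexx.
apply: ereal_inf_lbound; exists (f s + e1) => //; split; first exact: ltr_wpDl.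
have sY : s <= Y (f s + e1).
  apply: lb_le_inf; first by have [s' s'0 fs'] := f_unbounded (f s + e1); exists s'.
  move=> s' [s'0 fs']; rewrite leNgt; apply/negP => s's.
  have := f_nd s'0 (ltW s's); rewrite leNgt => /negP; apply.
  by apply: lt_trans fs'; rewrite ltrDl.
have SY : S <= total_claims x (N (Y (f s + e1))) by apply: total_nd; exact: N_nd.
have ce1 : c * e1 < S - (u + c * f s).
  apply: (@le_lt_trans _ _ (c * ((S - (u + c * f s)) / (2 * c)))).
    by rewrite ler_pM2l// ge_min lexx orbT.
  rewrite (_ : c * _ = (S - (u + c * f s)) / 2); first lra.
  by field; rewrite gt_eqF.
lra.
Qed.

(** A ruin instant lies in an operational step between [j h] and [j.+1 h]. The
    count at the right end includes the claims that caused ruin, and the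
    barrier at the left end is at most the actual one, so the grid sees a ruin
    no later than [f (j h) <= t]. *)
Lemma ruin_grid_ruin (t : R) : N 0 = 0%N -> (T <= t%:E)%E -> exists j : nat,
  ruined_at x (fun j => N (j.+1%:R * h)) (fun j => b j) j /\ f (j%:R * h) <= t.
Proof.
move=> N0 Tt.
have grid t' : g t' < 0 -> 0 < t' -> exists j : nat,
    b j < total_claims x (N (j.+1%:R * h)) /\ f (j%:R * h) <= t'.
  move=> gt' t'0; have Y0 : 0 < Y t'.
    rewrite lt_neqAle first_passage_ge0 andbT; apply/negP => /eqP Y0.
    move: gt'; rewrite -Y0 N0 /total_claims big_ord0 subr0.
    by apply/negP; rewrite -leNgt addr_ge0 ?mulr_ge0 ?ltW.
  have exj : exists j : nat, Y t' <= j.+1%:R * h.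
    exists (Num.truncn (Y t' / h)); rewrite -ler_pdivrMr// ltW//.
    exact: truncnS_gt.
  have [j jY Yj] : exists2 j : nat, j%:R * h < Y t' & Y t' <= j.+1%:R * h.
    case: (ex_minnP exj) => -[|j] Yj jmin; first by exists 0%N; rewrite ?mul0r.
    by exists j.+1 => //; rewrite ltNge; apply/negP => /jmin; rewrite ltnn.
  have j0 : 0 <= j%:R * h by rewrite mulr_ge0// ltW.
  have fj : f (j%:R * h) <= t'.
    rewrite leNgt; apply/negP => /(first_passage_le j0).
    by rewrite leNgt jY.
  exists j; split => //.
  apply: (@lt_le_trans _ _ (total_claims x (N (Y t')))).
    apply: (@le_lt_trans _ _ (u + c * t')); last by rewrite -subr_lt0.
    by rewrite lerD2l ler_pM2l.
  by apply: total_nd; apply: N_nd => //; exact: ltW.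
have near e : 0 < e -> exists t', [/\ g t' < 0, 0 < t' & t' < t + e].
  move=> e0; have : (T < (t + e)%:E)%E by apply: le_lt_trans Tt _; rewrite lte_fin ltrDl.
  by case/ereal_inf_lt => _ [t' [t'0 gt'] <-]; rewrite lte_fin => t'e; exists t'.
have ex : exists j, b j < total_claims x (N (j.+1%:R * h)).
  by have [t' [gt' t'0 _]] := near _ ltr01; have [j [bj _]] := grid _ gt' t'0; exists j.
case: (ex_minnP ex) => j bj jmin; exists j; split.
  apply/andP; split=> //; apply/survives_beforeP => i ij.
  by rewrite leNgt; apply/negP => /jmin; rewrite leqNgt ij.
apply/ler_addgt0Pr => e e0.
have [t' [gt' t'0 t'e]] := near _ e0; have [k [bk fk]] := grid _ gt' t'0.
apply: (le_trans _ (ltW t'e)); apply: le_trans fk; apply: f_nd.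
  by rewrite mulr_ge0// ltW.
by rewrite ler_pM2r// ler_nat; exact: jmin.
Qed.

Lemma ruined_at_once (n : nat -> nat) (b' : nat -> R) j k :
  ruined_at x n b' j -> ruined_at x n b' k -> j = k.
Proof.
wlog jk : j k / (j < k)%N.
  move=> H hj hk; have [jk|kj|//] := ltngtP j k; first exact: H jk hj hk.
  by apply/esym; exact: H kj hk hj.
by move=> /andP[_ bj] /andP[/survives_beforeP/(_ _ jk)]; rewrite leNgt bj.
Qed.

End grid_ruin.

(** * Measurability of the ruin event *)

(** The sample space with the sigma-algebra of a subfamily of variables: the
    independence hypotheses are about these sigma-algebras. *)
Notation generated_by J Z := (g_sigma_algebraType
  (\bigcup_(i in J) preimage_set_system setT (Z i) measurable)).

Section generated_by.
Context d d' (T : measurableType d) (U : measurableType d') (I : Type).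
Variables (J : set I) (Z : I -> T -> U).

Lemma measurable_generated_by i : J i ->
  measurable_fun setT (Z i : generated_by J Z -> U).
Proof.
move=> Ji _ B mB; apply: sub_sigma_algebra; exists i => //=.
by exists B.
Qed.

Lemma measurable_to_generated_by :
  (forall i, J i -> measurable_fun setT (Z i)) ->
  measurable_fun setT (id : T -> generated_by J Z).
Proof.
move=> mZ _ A mA; rewrite setTI.
apply: (smallest_sub (@sigma_algebra_measurable _ T) _ mA).
by move=> _ [i Ji [B mB <-]]; exact: mZ.
Qed.

End generated_by.

Lemma measurable_nat_leqP d (T : measurableType d) (f : T -> nat) :
  (forall k, measurable [set w | (f w <= k)%N]) -> measurable_fun setT f.
Proof.
move=> mf _ B _; rewrite setTI.
have mk k : measurable (f @^-1` [set k]).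
  case: k => [|k].
    rewrite (_ : _ @^-1` _ = [set w | (f w <= 0)%N])//.
    by apply/seteqP; split => w /=; rewrite leqn0 => /eqP.
  rewrite (_ : _ @^-1` _ = [set w | (f w <= k.+1)%N] `\` [set w | (f w <= k)%N]).
    exact: measurableD.
  apply/seteqP; split => w /=; first by move=> ->; rewrite leqnn ltnn.
  by case=> fk /negP; rewrite -ltnNge => kf; apply/eqP; rewrite eqn_leq fk.
rewrite (_ : f @^-1` B = \bigcup_(k in B) f @^-1` [set k]).
  exact: bigcup_measurable.
by apply/seteqP; split => [w Bw|w [k Bk /= ->]//]; exists (f w).
Qed.

Section time_change.
Context d1 d2 (T1 : measurableType d1) (T2 : measurableType d2) (R : realType).
Variables (N : R -> T1 -> nat) (Y : T2 -> R).
Hypothesis mN : forall t, 0 <= t -> measurable_fun setT (N t).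
Hypothesis N_nd : forall w s t, 0 <= s -> s <= t -> (N s w <= N t w)%N.
Hypothesis N_right : forall w t, 0 <= t ->
  exists2 e : R, 0 < e & forall t', t <= t' < t + e -> N t' w = N t w.
Hypotheses (mY : measurable_fun setT Y) (Y_ge0 : forall w, 0 <= Y w).

(** For a nondecreasing right-continuous count, [N Y <= k] holds iff
    [N q <= k] for some rational [q > Y]. *)
Lemma measurable_time_change :
  measurable_fun setT (fun w : T1 * T2 => N (Y w.2) w.1).
Proof.
apply: measurable_nat_leqP => k.
rewrite (_ : [set w | _] = \bigcup_q (if 0 <= ratr q :> R then
    [set w1 | (N (ratr q) w1 <= k)%N] `*` [set w2 | Y w2 < ratr q] else set0)).
  apply: bigcupT_measurable_rat => q; case: ifPn => // q0; apply: measurableX.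
    rewrite -[X in measurable X]setTI.
    by have /(_ measurableT [set i | (i <= k)%N]) := mN q0; apply.
  rewrite -[X in measurable X]setTI.
  rewrite (_ : [set w | _] = (fun w => Y w < ratr q) @^-1` [set true])//.
  exact: measurable_fun_ltr.
apply/seteqP; split => [[w1 w2] /= Nk|[w1 w2] [q _]].
  have [e e0 He] := N_right w1 (Y_ge0 w2).
  have [q] : exists q, ratr q \in `](Y w2), (Y w2 + e)[.
    by apply: rat_in_itvoo; rewrite ltrDl.
  rewrite in_itv/= => /andP[Yq qe]; exists q => //=.
  rewrite (le_trans (Y_ge0 w2) (ltW Yq)); split => //=.
  by rewrite He// (ltW Yq).
case: ifPn => // q0 [/= Nk Yq]; apply: leq_trans Nk.
by apply: N_nd => //; exact: ltW.
Qed.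

End time_change.

Section ruin_event.
Context d1 d3 (T1 : measurableType d1) (T3 : measurableType d3) (R : realType).
Variables (u c : R) (M : R -> T1 -> nat) (X : nat -> T3 -> R).
Hypothesis c_gt0 : 0 < c.
Hypothesis mM : forall t, 0 <= t -> measurable_fun setT (M t).
Hypothesis M_right : forall w t, 0 <= t ->
  exists2 e : R, 0 < e & forall t', t <= t' < t + e -> M t' w = M t w.
Hypothesis mX : forall i, measurable_fun setT (X i).

Definition ruin_event t : set (T1 * T3) :=
  [set w | (ruin_time (risk_process u c (fun t w => M t w.1)
    (fun i w => X i w.2)) w <= t%:E)%E].

Let g t (w : T1 * T3) := u + c * t - total_claims (X^~ w.2) (M t w.1).

Let g_right w t : 0 < t -> g t w < 0 ->
  exists2 e, 0 < e & forall t', t <= t' < t + e -> g t' w < 0.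
Proof.
move=> t0 gt; have [e e0 He] := M_right w.1 (ltW t0).
exists (Num.min e (- g t w / c)).
  by rewrite lt_min e0 divr_gt0// oppr_gt0.
move=> t' /andP[tt' t'e]; rewrite /g He; last first.
  by rewrite tt' (lt_le_trans t'e)// lerD2l ge_min lexx.
have : t' < t + - g t w / c by rewrite (lt_le_trans t'e)// lerD2l ge_min lexx orbT.
rewrite -ltrBlDl ltr_pdivlMr//; rewrite /g; lra.
Qed.

(** A countable combination of events at rational instants, by
    [ruin_time_le_ratP]. *)
Lemma measurable_ruin_event t : measurable (ruin_event t).
Proof.
rewrite (_ : ruin_event t = \bigcap_k \bigcup_q
    (if (0 < ratr q :> R) && (ratr q < t + k.+1%:R^-1) then
     [set w | g (ratr q) w < 0] else set0)).
  apply: bigcapT_measurable => k; apply: bigcupT_measurable_rat => q.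
  case: ifPn => // /andP[q0 _].
  rewrite -[X in measurable X]setTI.
  rewrite (_ : [set w | _] = (fun w => g (ratr q) w < 0) @^-1` [set true])//.
  apply: measurable_fun_ltr => //; apply: measurable_funB => //.
  have mpair : measurable_fun setT (fun w : T1 * T3 => (w.1, tt, w.2)).
    by apply: measurable_fun_pair => //; exact: measurable_fun_pair.
  exact: (measurableT_comp (measurable_random_total (T1 := T1) (T2 := unit)
    mX (mM (ltW q0))) mpair).
apply/seteqP; split => w.
  move=> /(ruin_time_le_ratP t (g_right (w := w))) H k _.
  by have [q [q0 qk gq]] := H k; exists q => //; rewrite q0 qk.
move=> H; apply/(ruin_time_le_ratP t (g_right (w := w))) => k.
by have [q _] := H k I; case: ifPn => // /andP[q0 qk] gq; exists q.
Qed.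

End ruin_event.

(** * Decoupling the Poisson process, the subordinator and the claims *)

Definition product_probability d1 d2 (T1 : measurableType d1)
    (T2 : measurableType d2) (R : realType) (P1 : probability T1 R)
    (P2 : probability T2 R) : probability (T1 * T2)%type R :=
  [the probability _ R of product_measure1 P1 P2].

Section product_probability.
Context d1 d2 (T1 : measurableType d1) (T2 : measurableType d2) (R : realType).
Variables (P1 : probability T1 R) (P2 : probability T2 R).
Variable f : T1 * T2 -> \bar R.
Hypotheses (mf : measurable_fun setT f) (f0 : forall z, (0 <= f z)%E).
Local Open Scope ereal_scope.

Lemma integral_product12 :
  \int[product_probability P1 P2]_z f z = \int[P1]_x \int[P2]_y f (x, y).
Proof. exact: (fubini_tonelli1 (m1 := P1) (m2 := P2) f mf f0). Qed.

Lemma integral_product21 :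
  \int[product_probability P1 P2]_z f z = \int[P2]_y \int[P1]_x f (x, y).
Proof. exact: (fubini_tonelli2 (m1 := P1) (m2 := P2) f mf f0). Qed.

Lemma product_probabilityX (A1 : set T1) (A2 : set T2) :
  measurable A1 -> measurable A2 ->
  product_probability P1 P2 (A1 `*` A2) = P1 A1 * P2 A2.
Proof. exact: product_measure1E. Qed.

End product_probability.

Section ruin_decoupling.
Context d (T : measurableType d) (R : realType) (P : probability T R).
Variables (u c : R) (N : R -> T -> nat) (D : R -> T -> R) (X : nat -> T -> R).
Hypothesis c_gt0 : 0 < c.
Hypothesis mN : forall t, 0 <= t -> measurable_fun setT (N t).
Hypothesis N_nd : forall w s t, 0 <= s -> s <= t -> (N s w <= N t w)%N.
Hypothesis N_right : forall w t, 0 <= t ->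
  exists2 e : R, 0 < e & forall t', t <= t' < t + e -> N t' w = N t w.
Hypothesis mD : forall t, 0 <= t -> measurable_fun setT (D t).
Hypothesis D_nd : nondecreasing_paths D.
Hypothesis mX : forall i, measurable_fun setT (X i).
Local Notation Y := (inverse_subordinator D).
Local Notation P2 := (product_probability P P).
Local Notation P3 := (product_probability P2 P).

(** [Y t < a] holds iff [D] exceeds [t] at some rational below [a], or never
    does while [0 < a], the infimum of the empty set being 0. *)
Lemma measurable_inverse_subordinator t : measurable_fun setT (Y t).
Proof.
have mlt (b : R -> T -> bool) s : 0 <= s -> (forall x w, b x w = (t < D x w)) ->
    measurable [set w | b s w].
  move=> s0 bE; rewrite -[X in measurable X]setTI.
  rewrite (_ : [set w | _] = (fun w => t < D s w) @^-1` [set true]).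
    by apply: measurable_fun_ltr => //; exact: mD.
  by apply/seteqP; split => w /=; rewrite bE.
apply: (measurability (@RGenInftyO.G R)) => [|/= _ [_] [a] -> <-].
  exact: RGenInftyO.measurableE.
rewrite setTI (_ : _ @^-1` _ =
    (\bigcup_q (if (0 <= ratr q :> R) && (ratr q < a) then
       [set w | t < D (ratr q) w] else set0)) `|`
    (if 0 < a then \bigcap_n (~` [set w | t < D n%:R w]) else set0)).
  apply: measurableU.
    apply: bigcupT_measurable_rat => q; case: ifPn => // /andP[q0 _].
    exact: (mlt (fun x w => t < D x w)).
  case: ifPn => // _; apply: bigcapT_measurable => n; apply: measurableC.
  exact: (mlt (fun x w => t < D x w)).
apply/seteqP; split => w /=; rewrite in_itv/=.
  move=> Ya; have a0 : 0 < a by apply: le_lt_trans Ya; exact: first_passage_ge0.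
  have [E0|[s [s0 ts sa]]] := first_passage_ltP Ya.
    right; rewrite a0 => n _ /= tD.
    by have : [set s | 0 <= s /\ t < D s w] n%:R by []; rewrite E0.
  have [q] := rat_in_itvoo sa; rewrite in_itv/= => /andP[sq qa].
  left; exists q => //; rewrite (le_trans s0 (ltW sq)) qa/=.
  by apply: lt_le_trans ts _; apply: D_nd => //; exact: ltW.
case=> [[q _]|].
  case: ifPn => // /andP[q0 qa] /= tq.
  by apply: le_lt_trans qa; exact: (first_passage_le (f := fun s => D s w)).
case: ifPn => // a0 H; rewrite /inverse_subordinator.
rewrite (_ : [set s | _] = set0) ?inf0//; apply/seteqP; split => // s [s0 ts].
have /= := H (Num.truncn s).+1 I; apply; apply: (lt_le_trans ts).
by apply: D_nd => //; rewrite ltW// truncnS_gt.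
Qed.

Let Y_ge0 t w : 0 <= Y t w. Proof. exact: first_passage_ge0. Qed.

(** The mixed process when the Poisson process and the subordinator are read at
    two independent sample points. *)
Definition split_count t (w : T * T) : nat := N (Y t w.2) w.1.

Let split_count_right w t : 0 <= t ->
  exists2 e : R, 0 < e & forall t', t <= t' < t + e ->
    split_count t' w = split_count t w.
Proof.
move=> t0; have [e e0 He] := N_right w.1 (Y_ge0 t w.2).
have [d' d'0 Hd] := first_passage_right (fun s => D s w.2) t e0.
by exists d' => // t' /Hd; exact: He.
Qed.

Let mY t : measurable_fun setT (Y t) := measurable_inverse_subordinator t.

Lemma measurable_split_count t : measurable_fun setT (split_count t).
Proof. exact: measurable_time_change. Qed.

Lemma measurable_mixed_count t : measurable_fun setT (mixed_fractional_poisson N D t).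
Proof.
have mpair : measurable_fun setT (fun w : T => (w, w)).
  exact: measurable_fun_pair.
exact: (measurableT_comp (measurable_split_count t) mpair).
Qed.

Definition split_ruin_event t : set (T * T * T) := ruin_event u c split_count X t.

Lemma measurable_split_ruin_event t : measurable (split_ruin_event t).
Proof.
apply: measurable_ruin_event => // t' _; exact: measurable_split_count.
Qed.

Hypothesis N_indep_Y : independent_systems P
  (sigma_of (@time R) N) (sigma_of (@time R) Y).
Hypothesis X_indep_M : independent_systems P
  (sigma_of setT X) (sigma_of (@time R) (mixed_fractional_poisson N D)).
Local Open Scope ereal_scope.

(** Ruin depends on the claims and on the mixed process, which are independent,
    and the mixed process depends on [N] and [Y], which are independent; so the
    three sources may be read at independent sample points. The subordinator
    itself enters through its inverse alone, whence the whole path of [D] may be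
    used on its own coordinate. *)
Lemma ruin_probability_split t :
  ruin_probability P (risk_process u c (mixed_fractional_poisson N D) X) t =
  P3 (split_ruin_event t).
Proof.
pose TX := generated_by (@setT nat) X.
pose TM := generated_by (@time R) (mixed_fractional_poisson N D).
pose TN := generated_by (@time R) N.
pose TY := generated_by (@time R) Y.
have iX : measurable_fun setT (id : T -> TX) by exact: measurable_to_generated_by.
have iM : measurable_fun setT (id : T -> TM).
  by apply: measurable_to_generated_by => s _; exact: measurable_mixed_count.
have iN : measurable_fun setT (id : T -> TN).
  by apply: measurable_to_generated_by => s s0; exact: mN.
have iY : measurable_fun setT (id : T -> TY).
  by apply: measurable_to_generated_by => s _; exact: mY.
have indXM (A : set TX) (B : set TM) : measurable A -> measurable B ->
    P (id @^-1` A `&` id @^-1` B) = P (id @^-1` A) * P (id @^-1` B).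
  exact: X_indep_M.
have indNY (A : set TN) (B : set TY) : measurable A -> measurable B ->
    P (id @^-1` A `&` id @^-1` B) = P (id @^-1` A) * P (id @^-1` B).
  exact: N_indep_Y.
have M_right w s : (0 <= s)%R -> exists2 e : R, (0 < e)%R & forall s',
    (s <= s' < s + e)%R ->
    mixed_fractional_poisson N D s' w = mixed_fractional_poisson N D s w.
  by move=> s0; have [e e0 He] := split_count_right (w, w) s0; exists e.
pose AM : set (TM * TX) := ruin_event u c
  (mixed_fractional_poisson N D : R -> TM -> nat) (X : nat -> TX -> R) t.
have mAM : measurable AM.
  apply: measurable_ruin_event => //.
  - by move=> s s0; exact: measurable_generated_by.
  - by move=> i; exact: measurable_generated_by.
have mAX : measurable [set z : TX * TM | AM (z.2, z.1)].
  rewrite -[X in measurable X]setTI.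
  exact: (measurable_fun_pair measurable_snd measurable_fst).
pose AN w3 : set (TN * TY) := [set w | split_ruin_event t (w, w3)].
have mAN w3 : measurable (AN w3).
  have mE : measurable (ruin_event (T1 := (TN * TY)%type) u c
      (split_count : R -> TN * TY -> nat) X t).
    apply: measurable_ruin_event => // s s0.
    apply: (measurable_time_change (T1 := TN) (T2 := TY)) => //.
      by move=> s' s'0; exact: measurable_generated_by.
    exact: measurable_generated_by.
  rewrite -[X in measurable X]setTI.
  exact: (pair2_measurable (T1 := (TN * TY)%type) w3 measurableT mE).
have -> : ruin_probability P (risk_process u c (mixed_fractional_poisson N D) X) t =
    \int[P]_w3 P [set w | AM (w, w3)].
  exact: (probability_decoupling iX iM indXM mAX).
transitivity (\int[P]_w3 \int[P]_w1 P [set w2 | AN w3 (w1, w2)]).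
  apply: eq_integral => w3 _.
  exact: (probability_decoupling iN iY indNY (mAN w3)).
transitivity (\int[P3]_w (\1_(split_ruin_event t) w)%:E); last first.
  by rewrite integral_indic ?setIT//; exact: measurable_split_ruin_event.
have mI : measurable_fun setT
    (fun w : T * T * T => (\1_(split_ruin_event t) w)%:E : \bar R).
  by apply/measurable_EFinP; apply: measurable_indic; exact: measurable_split_ruin_event.
have I0 w : 0 <= (\1_(split_ruin_event t) w)%:E :> \bar R by rewrite lee_fin.
rewrite [RHS](integral_product21 P2 P mI I0).
apply: eq_integral => w3 _.
have mAN' : measurable (AN w3 : set (T * T)).
  rewrite -[X in measurable X]setTI.
  exact: (pair2_measurable (T1 := (T * T)%type) w3 measurableT
    (measurable_split_ruin_event t)).
transitivity (P2 (AN w3)).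
  apply: eq_integral => w1 _; congr (P _).
  by apply/seteqP; split => w2; rewrite /xsection/= in_setE.
by rewrite (measureE_integral_indic _ mAN').
Qed.

End ruin_decoupling.

(** * Poisson moments *)

Lemma eq_law_integral d1 d2 (T1 : measurableType d1) (T2 : measurableType d2)
    (R : realType) (P1 : probability T1 R) (P2 : probability T2 R)
    (xi : T1 -> R) (eta : T2 -> R) (f : R -> \bar R) :
  measurable_fun setT xi -> measurable_fun setT eta ->
  (forall B, measurable B -> P1 (xi @^-1` B) = P2 (eta @^-1` B)) ->
  measurable_fun setT f -> (forall x, (0 <= f x)%E) ->
  (\int[P1]_w f (xi w) = \int[P2]_w f (eta w))%E.
Proof.
move=> mxi meta lawE mf f0.
pose X1 : {mfun T1 >-> R} := HB.pack xi (isMeasurableFun.Build _ _ _ _ _ mxi).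
pose X2 : {mfun T2 >-> R} := HB.pack eta (isMeasurableFun.Build _ _ _ _ _ meta).
transitivity (\int[distribution P1 X1]_x f x)%E.
  by rewrite ge0_integral_distribution.
transitivity (\int[distribution P2 X2]_x f x)%E.
  by apply: eq_measure_integral => A mA _; exact: lawE.
by rewrite ge0_integral_distribution.
Qed.

Lemma integral_nat_law d (T : measurableType d) (R : realType)
    (P : probability T R) (f : T -> nat) (g : nat -> R) :
  measurable_fun setT f -> (forall k, 0 <= g k) ->
  (\int[P]_w (g (f w))%:E = \sum_(k <oo) (g k)%:E * P [set w | f w = k])%E.
Proof.
move=> mf g0.
have mk k : measurable [set w | f w = k].
  by rewrite -[X in measurable X]setTI; exact: (mf measurableT [set k]).
have Tk : [set: T] = \bigcup_k [set w | f w = k].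
  by apply/seteqP; split => // w _; exists (f w).
rewrite {1}Tk ge0_integral_bigcup//; last 3 first.
- by rewrite -Tk; apply/measurable_EFinP; exact: measurableT_comp.
- by move=> w _; rewrite lee_fin.
- by move=> i j _ _ [w [/= <- <-]].
apply: eq_eseriesr => k _; rewrite -integral_cst//.
by apply: eq_integral => w; rewrite in_setE /= => ->.
Qed.

Section poisson_moments.
Context d (T : measurableType d) (R : realType) (P : probability T R).
Variables (a v : R) (f : T -> nat).
Hypotheses (a_gt0 : 0 < a) (v_ge1 : 1 <= v) (mf : measurable_fun setT f).
Hypothesis f_law : forall k, P [set w | f w = k] = (poisson_pmf a k)%:E.
Local Open Scope ereal_scope.

Let v_gt0 : (0 < v)%R. Proof. exact: lt_le_trans v_ge1. Qed.

Lemma poisson_exponential_moment :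
  \int[P]_w (v ^+ f w)%:E = (expR (a * v - a))%:E.
Proof.
rewrite (integral_nat_law P (g := fun k => v ^+ k)%R mf); last first.
  by move=> k; rewrite exprn_ge0// ltW.
have av0 : (0 < a * v)%R by rewrite mulr_gt0.
transitivity ((expR (a * v - a))%:E * \sum_(k <oo) (poisson_pmf (a * v) k)%:E).
  rewrite -nneseriesZl; last by move=> k _; rewrite lee_fin poisson_pmf_ge0.
  apply: eq_eseriesr => k _; rewrite f_law -EFinM /poisson_pmf a_gt0 av0.
  congr (_%:E); rewrite exprMn expRD (expRN (a * v)).
  by field; rewrite gt_eqF ?expR_gt0//= pnatr_eq0 -lt0n fact_gt0.
rewrite nneseries_esumT; last by move=> k; rewrite lee_fin poisson_pmf_ge0.
rewrite (_ : \esum_(k in setT) _ = 1) ?mule1//.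
rewrite -[RHS](probability_setT (poisson_prob (a * v) 0%N)).
transitivity (if (0 < a * v)%R then \esum_(k in [set: nat])
  (poisson_pmf (a * v) k)%:E else \d_0%N [set: nat]); last by [].
by rewrite av0.
Qed.

(** Two claims or more in a step of mean [a] have a weight of order a^2: removing
    the values 0 and 1 from the exponential moment leaves
    e^{-a} (e^b - 1 - b) with b = a v. *)
Lemma poisson_double_moment :
  \int[P]_w ((1 < f w)%N%:R * v ^+ f w)%:E <= ((a * v) ^+ 2 * expR (a * v))%:E.
Proof.
have mk k : measurable [set w | f w = k].
  rewrite -[X in measurable X]setTI.
  by have /(_ measurableT [set k]) := mf; apply.
have few : \int[P]_w ((f w <= 1)%N%:R * v ^+ f w)%:E =
    (expR (- a) * (1 + a * v))%:E.
  transitivity (\int[P]_w ((\1_[set w | f w = 0%N] w)%:E +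
      v%:E * (\1_[set w | f w = 1%N] w)%:E)).
    apply: eq_integral => w _; rewrite !indicE -EFinM -EFinD; congr (_%:E).
    have inE' k : (w \in [set w | f w = k]) = (f w == k).
      by apply/idP/eqP; rewrite in_setE.
    rewrite !inE'; case: (f w) => [|[|k]]; rewrite /= ?expr0 ?expr1; ring.
  rewrite ge0_integralD//; last 3 first.
  - by apply/measurable_EFinP; exact: measurable_indic.
  - by move=> w _; rewrite mule_ge0 ?lee_fin// ltW.
  - by apply: emeasurable_funM => //; apply/measurable_EFinP; exact: measurable_indic.
  rewrite ge0_integralZl//; last 2 first.
  - by apply/measurable_EFinP; exact: measurable_indic.
  - by rewrite lee_fin ltW.
  have iE k : \int[P]_w (\1_[set w | f w = k] w)%:E = (poisson_pmf a k)%:E.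
    by rewrite -f_law (measureE_integral_indic P (mk k)).
  rewrite !iE /poisson_pmf a_gt0 -EFinM -EFinD.
  by congr (_%:E); rewrite expr0 expr1 !fact0 ?factS ?fact0 !muln1 invr1; ring.
have split : \int[P]_w (v ^+ f w)%:E =
    \int[P]_w ((f w <= 1)%N%:R * v ^+ f w)%:E +
    \int[P]_w ((1 < f w)%N%:R * v ^+ f w)%:E.
  have mg (q : nat -> R) : measurable_fun setT (fun w => (q (f w))%:E).
    by apply/measurable_EFinP; exact: measurableT_comp.
  rewrite -ge0_integralD//; last 4 first.
  - by move=> w _; rewrite lee_fin mulr_ge0// exprn_ge0// ltW.
  - exact: (mg (fun k => (k <= 1)%N%:R * v ^+ k)%R).
  - by move=> w _; rewrite lee_fin mulr_ge0// exprn_ge0// ltW.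
  - exact: (mg (fun k => (1 < k)%N%:R * v ^+ k)%R).
  apply: eq_integral => w _; rewrite -EFinD -mulrDl ltnNge.
  by case: (f w <= 1)%N; rewrite ?addr0 ?add0r mul1r.
move: split; rewrite poisson_exponential_moment few.
set I := \int[P]_w _ => split.
have I0 : 0 <= I.
  by apply: integral_ge0 => w _; rewrite lee_fin mulr_ge0// exprn_ge0// ltW.
have /fineK Ifin : I \is a fin_num.
  rewrite ge0_fin_numE//; apply: (@le_lt_trans _ _ (expR (a * v - a))%:E).
    rewrite split leeDr// lee_fin mulr_ge0 ?expR_ge0// addr_ge0// mulr_ge0// ltW//.
  exact: ltry.
move: split; rewrite -Ifin -EFinD => -[] split; rewrite lee_fin.
have -> : fine I = (expR (- a) * (expR (a * v) - 1 - a * v))%R.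
  move: split; rewrite expRD; lra.
set b := (a * v)%R; have b0 : (0 < b)%R by rewrite mulr_gt0.
have ea1 : (expR (- a) <= 1)%R by rewrite expR_le1 oppr_le0 ltW.
have key : (expR b - 1 - b <= b ^+ 2 * expR b)%R.
  have [b1|b1] := leP b 1%R; last first.
    have : (expR b <= b ^+ 2 * expR b)%R.
      by rewrite ler_peMl ?expR_ge0// exprn_ege1// ltW.
    by apply: le_trans; lra.
  have : ((1 - b) * expR b <= 1)%R.
    have := expR_ge1Dx (- b)%R; rewrite -(@ler_pM2r _ (expR b)) ?expR_gt0//.
    by rewrite -expRD addNr expR0.
  have := expR_ge0 b; nra.
have := expR_ge1Dx b; have := expR_ge0 (- a)%R; nra.
Qed.

End poisson_moments.

(** * Sandwiching a Laplace transform between two sums *)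

(* [E t] is an event of the form: ruin up to time [t]. It is compared, up to the
   null set [Z], with the events that some [B j] happens with [tau j <= t]. *)
Section laplace_sandwich.
Context d (T : measurableType d) (R : realType) (Q : probability T R).
Variables (E : R -> set T) (Z : set T) (B : nat -> set T) (tau : nat -> T -> R).
Variable s : R.
Hypotheses (s_gt0 : 0 < s) (mE : forall t, measurable (E t)) (mZ : measurable Z).
Hypotheses (E_nd : forall t t', t <= t' -> E t `<=` E t') (Z0 : Q Z = 0%E).
Hypotheses (mB : forall j, measurable (B j)).
Hypothesis mtau : forall j, measurable_fun setT (tau j).
Hypothesis tau_ge0 : forall j w, 0 <= tau j w.
Local Notation before j t := (B j `&` [set w | tau j w <= t]).
Local Open Scope ereal_scope.
Local Notation mass j := (\int[Q]_w ((expR (- s * tau j w))%:E * (\1_(B j) w)%:E)).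

Lemma measurable_nondecreasing_mass (F : R -> set T) :
  (forall t, measurable (F t)) -> (forall t t', (t <= t')%R -> F t `<=` F t') ->
  measurable_fun setT (fun t : measurableTypeR R => Q (F t)).
Proof.
move=> mF F_nd.
rewrite (_ : (fun _ => _) = (fun t => (fine (Q (F t)))%:E)); last first.
  by apply/funext => t; rewrite fineK// fin_num_measure.
apply/measurable_EFinP; apply: nondecreasing_measurable => // t t' tt'.
by rewrite fine_le ?fin_num_measure// le_measure ?inE//; exact: F_nd.
Qed.

Let before_nd j t t' : (t <= t')%R -> before j t `<=` before j t'.
Proof. by move=> tt' w [Bw /= /le_trans wt]; split => //=; exact: wt. Qed.

Let mbefore j t : measurable (before j t).
Proof. exact: measurable_before. Qed.

Let mlap (F : R -> \bar R) : measurable_fun setT (F : measurableTypeR R -> \bar R) ->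
  measurable_fun (`[0%R, +oo[%classic : set (measurableTypeR R))
    (fun t => (expR (- s * t))%:E * F t).
Proof.
move=> mF; apply: emeasurable_funM; last exact: measurable_funTS.
rewrite (_ : (fun _ => _) = (fun t : R => (1 * expR (- s * t))%:E)).
  exact: measurable_MexpNM.
by apply/funext => t; rewrite mul1r.
Qed.

Let laplaceE j : laplace_transform (fun t => Q (before j t)) s = (s^-1)%:E * mass j.
Proof. exact: laplace_random_time. Qed.

Lemma laplace_le_sum :
  (forall t, (0 <= t)%R -> E t `<=` (\bigcup_j before j t) `|` Z) ->
  laplace_transform (fun t => Q (E t)) s <= \sum_(j <oo) (s^-1)%:E * mass j.
Proof.
move=> EB.
have mF j := mlap (measurable_nondecreasing_mass (mbefore j) (@before_nd j)).
rewrite (eq_eseriesr (g := fun j => laplace_transform (fun t => Q (before j t)) s)); last first.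
  by move=> j _; rewrite laplaceE.
rewrite /laplace_transform -integral_nneseries//; last first.
  by move=> j t _; rewrite mule_ge0 ?lee_fin ?expR_ge0.
apply: ge0_le_integral => //.
- by move=> t _; rewrite mule_ge0 ?lee_fin ?expR_ge0.
- by apply: mlap; exact: measurable_nondecreasing_mass.
- by apply: ge0_emeasurable_sum => // j t _ _; rewrite mule_ge0 ?lee_fin ?expR_ge0.
move=> t /=; rewrite in_itv/= andbT => t0.
rewrite nneseriesZl//; apply: lee_wpmul2l; first by rewrite lee_fin expR_ge0.
apply: (@le_trans _ _ (Q (\bigcup_j before j t) + Q Z)); last first.
  by rewrite Z0 adde0; apply: measure_sigma_subadditive => //; exact: bigcupT_measurable.
apply: (@le_trans _ _ (Q ((\bigcup_j before j t) `|` Z))).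
  apply: le_measure; rewrite ?inE//; last exact: EB.
  by apply: measurableU => //; exact: bigcupT_measurable.
by apply: measureU2 => //; exact: bigcupT_measurable.
Qed.

Lemma laplace_ge_sum J : trivIset setT B ->
  (forall j t, (0 <= t)%R -> before j t `<=` E t `|` Z) ->
  \sum_(j < J) (s^-1)%:E * mass j <= laplace_transform (fun t => Q (E t)) s.
Proof.
move=> tB BE.
have mF j := mlap (measurable_nondecreasing_mass (mbefore j) (@before_nd j)).
under eq_bigr do rewrite -laplaceE.
rewrite /laplace_transform -ge0_integral_sum//; last first.
  by move=> j t _; rewrite mule_ge0 ?lee_fin ?expR_ge0.
apply: ge0_le_integral => //.
- by move=> t _; apply: sume_ge0 => j _; rewrite mule_ge0 ?lee_fin ?expR_ge0.
- exact: emeasurable_sum.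
- by apply: mlap; exact: measurable_nondecreasing_mass.
move=> t /=; rewrite in_itv/= andbT => t0.
rewrite -ge0_sume_distrr//; apply: lee_wpmul2l; first by rewrite lee_fin expR_ge0.
apply: (@le_trans _ _ (Q (E t) + Q Z)); last by rewrite Z0 adde0.
apply: (@le_trans _ _ (Q (E t `|` Z))); last exact: measureU2.
rewrite -(@measure_bigsetU _ _ _ Q (fun j => before j t))//; last first.
  by apply/trivIsetP => i j _ _ ij; apply/seteqP; split => // w [[Bi _] [Bj _]];
    have /trivIsetP/(_ i j I I ij)/seteqP[/(_ w) + _] := tB; apply.
apply: le_measure; rewrite ?inE//.
- exact: bigsetU_measurable.
- exact: measurableU.
- by rewrite -(bigcup_mkord J (fun j => before j t)); apply: bigcup_sub => j _; exact: BE.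
Qed.

End laplace_sandwich.

(** * Discounted mass of grid ruin *)

Section levy_grid.
Context d (T : measurableType d) (R : realType) (P : probability T R).
Variables (Z : R -> T -> R) (h : R).
Hypotheses (Z_levy : levy_process P Z) (h_gt0 : 0 < h).

Definition grid_increment i w := Z (i.+1%:R * h) w - Z (i%:R * h) w.

Let grid_ge0 (i : nat) : 0 <= i%:R * h. Proof. by rewrite mulr_ge0// ltW. Qed.

Lemma measurable_grid_increment i : measurable_fun setT (grid_increment i).
Proof.
by apply: measurable_funB; exact: (levy_measurable Z_levy).
Qed.

Lemma grid_increment_indep : mutually_independent P grid_increment.
Proof.
apply: (levy_independent Z_levy (t := fun i => i%:R * h)); first exact: grid_ge0.
by move=> i j ij; rewrite ler_pM2r// ler_nat.
Qed.

Lemma sum_grid_increment j w : \sum_(i < j) grid_increment i w = Z (j%:R * h) w.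
Proof.
rewrite -(big_mkord xpredT (fun i => grid_increment i w)).
rewrite (telescope_sumr (fun i => Z (i%:R * h) w))//.
by rewrite mul0r (levy_start Z_levy) subr0.
Qed.

Lemma integral_grid_increment i (f : R -> \bar R) :
  measurable_fun setT f -> (forall x, (0 <= f x)%E) ->
  (\int[P]_w f (grid_increment i w) = \int[P]_w f (Z h w))%E.
Proof.
move=> mf f0; apply: eq_law_integral => //.
- exact: measurable_grid_increment.
- by apply: (levy_measurable Z_levy); exact: ltW.
move=> B mB; have := levy_stationary Z_levy (grid_ge0 i) (ltW h_gt0) mB.
have -> : (fun w => Z (i%:R * h + h) w - Z (i%:R * h) w) = grid_increment i.
  by apply/funext => w; rewrite /grid_increment -natr1 mulrDl mul1r.
have -> // : (fun w => Z h w - Z 0 w) = Z h.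
by apply/funext => w; rewrite (levy_start Z_levy) subr0.
Qed.

End levy_grid.

Definition laplace_exponent (R : realType) (C1 C2 alpha1 alpha2 q : R) : R :=
  C1 * q `^ alpha1 + C2 * q `^ alpha2.

Section mixed_chain.
Context d (T : measurableType d) (R : realType) (P : probability T R).
Variables (alpha1 alpha2 lambda C1 C2 u c mu s y h : R).
Variables (D : R -> T -> R) (N : R -> T -> nat) (X : nat -> T -> R).
Local Notation psi := (laplace_exponent C1 C2 alpha1 alpha2).
Local Notation z := (s + c * (mu * (1 - y))).
Hypotheses (lambda_gt0 : 0 < lambda) (u_gt0 : 0 < u) (c_gt0 : 0 < c).
Hypotheses (mu_gt0 : 0 < mu) (h_gt0 : 0 < h) (s_gt0 : 0 < s).
Hypotheses (y_gt0 : 0 < y) (y_lt1 : y < 1).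
Hypothesis psi_ge0 : forall q, 0 <= psi q.
Hypothesis psi_z : psi z = lambda * y^-1 - lambda.
Hypothesis D_mixed : mixed_stable_subordinator P C1 C2 alpha1 alpha2 D.
Hypothesis N_poisson : poisson_process P lambda N.
Hypothesis mX : forall i, measurable_fun setT (X i).
Hypothesis X_indep : mutually_independent P X.
Hypothesis X_law : forall i B, measurable B ->
  P (X i @^-1` B) = exponential_prob mu B.

Let D_levy : levy_process P D. Proof. by case: D_mixed => -[]. Qed.
Let D_nd : nondecreasing_paths D. Proof. by case: D_mixed => -[]. Qed.
Let N_levy : levy_process P (fun t w => (N t w)%:R). Proof. by case: N_poisson. Qed.

Lemma poisson_path_nondecreasing w t t' : 0 <= t -> t <= t' -> (N t w <= N t' w)%N.
Proof.
by case: N_poisson => _ N_nd _ t0 tt'; have := N_nd w t t' t0 tt'; rewrite ler_nat.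
Qed.

Lemma poisson_path_start w : N 0 w = 0%N.
Proof. by have /eqP := levy_start N_levy w; rewrite pnatr_eq0 => /eqP. Qed.

Lemma measurable_poisson t : 0 <= t -> measurable_fun setT (N t).
Proof. by move=> t0; apply: measurable_nat_natr; exact: (levy_measurable N_levy t0). Qed.

Lemma poisson_path_right w t : 0 <= t ->
  exists2 e : R, 0 < e & forall t', t <= t' < t + e -> N t' w = N t w.
Proof.
by move=> t0; apply: right_continuous_nat_const; exact: (levy_cadlag N_levy w).1.
Qed.

Let dD i := grid_increment D h i.
Let dN i := grid_increment (fun t w => (N t w)%:R) h i.
Let v := y^-1.
Let v_ge1 : 1 <= v. Proof. by rewrite invf_ge1// ltW. Qed.
Let z_ge0 : 0 <= z.
Proof. by rewrite addr_ge0 ?(ltW s_gt0)// mulr_ge0 ?(ltW c_gt0)// mulr_ge0 ?subr_ge0 ?ltW. Qed.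

Let D_laplace q i : 0 <= q ->
  (\int[P]_w (expR (- q * dD i w))%:E = (expR (- h * psi q))%:E)%E.
Proof.
move=> q0; rewrite (integral_grid_increment D_levy h_gt0 i
    (f := fun x => (expR (- q * x))%:E)).
- by case: D_mixed => _ /(_ q h q0 (ltW h_gt0)); rewrite unlock.
- by apply/measurable_EFinP; apply: measurableT_comp => //; exact: mulrl_measurable.
- by move=> x; rewrite lee_fin expR_ge0.
Qed.

Let N_law k : P [set w | N h w = k] = (poisson_pmf (lambda * h) k)%:E.
Proof. by case: N_poisson => _ _; apply. Qed.

Let lh_gt0 : 0 < lambda * h. Proof. exact: mulr_gt0. Qed.

Let mNh : measurable_fun setT (N h).
Proof. by apply: measurable_poisson; exact: ltW. Qed.

Let count a j (w : T) : nat := N ((j + a)%:R * h) w.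

Let count_nd a j w : (count a j w <= count a j.+1 w)%N.
Proof.
apply: poisson_path_nondecreasing; first by rewrite mulr_ge0// ltW.
by rewrite ler_pM2r// ler_nat addSn.
Qed.

Let dNE a j w : dN (j + a)%N w = (count a j.+1 w - count a j w)%:R.
Proof. by rewrite natrB. Qed.

Let dN_moment a j (g : nat -> R) (f : R -> R) : measurable_fun setT f ->
  (forall x, 0 <= f x) -> (forall k, f k%:R = g k) ->
  (\int[P]_w (g (count a j.+1 w - count a j w)%N)%:E = \int[P]_w (g (N h w))%:E)%E.
Proof.
move=> mf f0 fg; transitivity (\int[P]_w (f (dN (j + a)%N w))%:E)%E.
  by apply: eq_integral => w _; rewrite dNE fg.
rewrite (integral_grid_increment N_levy h_gt0 (j + a) (f := fun x => (f x)%:E)).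
- by apply: eq_integral => w _; rewrite fg.
- exact/measurable_EFinP.
- by move=> x; rewrite lee_fin.
Qed.

Let mpow : measurable_fun setT (fun x : R => v `^ x).
Proof. exact: measurable_powRr. Qed.

Let v_ge0 : 0 <= v. Proof. exact: le_trans v_ge1. Qed.

Let count_moment a j :
  (\int[P]_w (v ^+ (count a j.+1 w - count a j w))%:E =
   (expR (lambda * h * v - lambda * h))%:E)%E.
Proof.
rewrite (@dN_moment a j (fun k => v ^+ k) (fun x => v `^ x))//.
- exact: poisson_exponential_moment.
- by move=> x; exact: powR_ge0.
- by move=> k; rewrite powR_mulrn.
Qed.

Let count_double a j :
  (\int[P]_w ((1 < count a j.+1 w - count a j w)%N%:R *
     v ^+ (count a j.+1 w - count a j w))%:E <=
   ((lambda * h * v) ^+ 2 * expR (lambda * h * v))%:E)%E.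
Proof.
rewrite (@dN_moment a j (fun k => (1 < k)%N%:R * v ^+ k)
  (fun x => (1 < x)%R%:R * v `^ x)).
- exact: poisson_double_moment.
- apply: measurable_funM => //; apply: measurable_boolR.
  exact: measurable_fun_ltr.
- by move=> x; rewrite mulr_ge0// powR_ge0.
- by move=> k; rewrite powR_mulrn// ltr1n.
Qed.

Let rho_M : expR (- h * psi z) * expR (lambda * h * v - lambda * h) = 1.
Proof. by rewrite psi_z -expRD -[RHS]expR0; congr expR; rewrite /v; ring. Qed.

Let dD_ge0 j w : 0 <= dD j w.
Proof.
rewrite subr_ge0; apply: D_nd; first by rewrite mulr_ge0// ltW.
by rewrite ler_pM2r// ler_nat.
Qed.

Local Notation mass a j := (chain_ruin_mass P s u c X (count a) (fun j => D (j%:R * h)) j).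
Local Open Scope ereal_scope.

Let countE a j w : (count a j w)%:R = (\sum_(i < j + a) dN i w)%R.
Proof. by rewrite (sum_grid_increment h N_levy). Qed.

Let DgridE j w : D (j%:R * h)%R w = (\sum_(i < j) dD i w)%R.
Proof. by rewrite (sum_grid_increment h D_levy). Qed.

(** With the count one step ahead, the initial weight is that of the claims of
    one step. *)
Lemma grid_ruin_mass_le J :
  (y^-1 * expR (mu * (1 - y) * u))%:E * \sum_(j < J) mass 1 j <=
  (expR (lambda * h * y^-1 - lambda * h))%:E.
Proof.
have <- : \int[P]_w (v ^+ count 1 0 w)%:E = (expR (lambda * h * v - lambda * h))%:E.
  rewrite /count add0n mul1r; exact: poisson_exponential_moment.
apply: (chain_total_ruin_mass_le (dN := dN) (dD := dD) (rho_z := expR (- h * psi z))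
  (M := expR (lambda * h * v - lambda * h)) mu_gt0 y_gt0 y_lt1 u_gt0 c_gt0 mX
  X_indep X_law _ _ _ _ (countE 1) (count_nd 1) DgridE dD_ge0 _ _ rho_M).
- exact: (measurable_grid_increment N_levy h_gt0).
- exact: (grid_increment_indep N_levy h_gt0).
- exact: (measurable_grid_increment D_levy h_gt0).
- exact: (grid_increment_indep D_levy h_gt0).
- by move=> i; exact: D_laplace.
- exact: expR_ge0.
- exact: count_moment.
Qed.

(** The error is the weight alive after [J] steps plus the weight of double
    claims, of order h^2 in each of them. *)
Lemma grid_ruin_mass_ge J :
  1 <= (y^-1 * expR (mu * (1 - y) * u))%:E * \sum_(j < J.+1) mass 0 j +
  (expR (mu * (1 - y) * u) * (expR (- h * psi s) ^+ J +
     J%:R * ((lambda * h * y^-1) ^+ 2 * expR (lambda * h * y^-1))))%:E.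
Proof.
apply: (chain_total_ruin_mass_ge (dN := dN) (dD := dD) (rho_z := expR (- h * psi z))
  (M := expR (lambda * h * v - lambda * h)) mu_gt0 y_gt0 y_lt1 u_gt0 c_gt0 mX
  X_indep X_law _ _ _ _ (countE 0) (count_nd 0) DgridE dD_ge0 _ _ _ _ _ _ rho_M).
- exact: (measurable_grid_increment N_levy h_gt0).
- exact: (grid_increment_indep N_levy h_gt0).
- exact: (measurable_grid_increment D_levy h_gt0).
- exact: (grid_increment_indep D_levy h_gt0).
- by move=> i; exact: D_laplace.
- by move=> i; apply: D_laplace; exact: ltW.
- exact: expR_ge0.
- by rewrite expR_le1 mulNr oppr_le0 mulr_ge0// ltW.
- exact: expR_ge0.
- by rewrite expR_le1 mulNr oppr_le0 mulr_ge0// ltW.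
- exact: count_moment.
- exact: count_double.
- by move=> w; rewrite /count mul0r poisson_path_start.
Qed.

End mixed_chain.

(** * Null sets *)

Section null_sets.
Context d (T : measurableType d) (R : realType) (P : probability T R).
Local Open Scope ereal_scope.

Lemma measure_bigcup_null (A : nat -> set T) : (forall i, measurable (A i)) ->
  (forall i, P (A i) = 0) -> P (\bigcup_i A i) = 0.
Proof.
move=> mA A0; apply/eqP; rewrite eq_le measure_ge0 andbT.
apply: (@le_trans _ _ (\sum_(i <oo) P (A i))).
  by apply: measure_sigma_subadditive => //; exact: bigcupT_measurable.
by rewrite eseries0.
Qed.

Lemma negative_claim_null (mu : R) (X : nat -> T -> R) :
  (forall i, measurable_fun setT (X i)) ->
  (forall i B, measurable B -> P (X i @^-1` B) = exponential_prob mu B) ->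
  measurable [set w | exists i, (X i w < 0)%R] /\
  P [set w | exists i, (X i w < 0)%R] = 0.
Proof.
move=> mX X_law.
have -> : [set w | exists i, (X i w < 0)%R] = \bigcup_i (X i @^-1` `]-oo, 0%R[).
  apply/seteqP; split => [w [i Xi]|w [i _ /=]]; first by exists i; rewrite //= in_itv.
  by rewrite in_itv/= => Xi; exists i.
have mA i : measurable (X i @^-1` `]-oo, 0%R[).
  by rewrite -[X in measurable X]setTI; exact: mX.
split; first exact: bigcupT_measurable.
apply: measure_bigcup_null => // i; rewrite X_law// /exponential_prob.
apply: integral0_eq => x; rewrite /= in_itv/= => x0.
by rewrite lt0_exponential_pdf.
Qed.

(** By Markov's inequality the event [D n <= K] has probability at most
    e^K E e^{-D n} = e^{K - n}. *)
Lemma bounded_path_null (D : R -> T -> R) :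
  (forall t, (0 <= t)%R -> measurable_fun setT (D t)) ->
  (forall t, (0 <= t)%R -> \int[P]_w (expR (- 1 * D t w))%:E = (expR (- t))%:E) ->
  measurable [set w | exists K : nat, forall n : nat, (D n%:R w <= K%:R)%R] /\
  P [set w | exists K : nat, forall n : nat, (D n%:R w <= K%:R)%R] = 0.
Proof.
move=> mD LD.
have -> : [set w | exists K : nat, forall n : nat, (D n%:R w <= K%:R)%R] =
    \bigcup_(K : nat) \bigcap_(n : nat) [set w | (D n%:R w <= K%:R)%R].
  apply/seteqP; split => [w [K H]|w [K _ H]]; exists K => // n.
    by move=> _; exact: H.
  exact: (H n I).
have mA (K n : nat) : measurable [set w | (D n%:R w <= K%:R)%R].
  rewrite -[X in measurable X]setTI.
  rewrite (_ : [set w | _] = (fun w => (D n%:R w <= K%:R)%R) @^-1` [set true])//.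
  by apply: measurable_fun_ler => //; exact: mD.
have mB (K : nat) : measurable (\bigcap_(n : nat) [set w | (D n%:R w <= K%:R)%R]).
  exact: bigcapT_measurable.
split; first exact: bigcupT_measurable.
apply: measure_bigcup_null => // K; set A := \bigcap_n _.
have PA n : P A <= (expR K%:R * expR (- n%:R))%:E.
  rewrite EFinM -LD// -ge0_integralZl//; last first.
    apply/measurable_EFinP; apply: measurableT_comp => //; apply: measurable_funM => //.
    exact: mD.
  rewrite (measureE_integral_indic P (mB K)); apply: ge0_le_integral => //.
  - by apply/measurable_EFinP; exact: measurable_indic.
  - apply: emeasurable_funM => //; apply/measurable_EFinP.
    apply: measurableT_comp => //; apply: measurable_funM => //.
    exact: mD.
  move=> w _; rewrite -EFinM lee_fin -expRD mulN1r indicE.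
  case: (boolP (w \in _)) => [|_]; last exact: expR_ge0.
  rewrite in_setE => /(_ n I)/= Dn.
  by rewrite -[X in (X <= _)%R]/(1%R) -[leLHS](@expR0 R) ler_expR subr_ge0.
have fA := fineK (fin_num_measure P A (mB K)).
rewrite -fA; congr (_%:E); apply/eqP; rewrite eq_le fine_ge0// andbT leNgt.
apply/negP => x0; set x := fine (P A) in x0 fA.
have [n nx] : exists n : nat, (expR K%:R < x * n%:R)%R.
  exists (Num.truncn (expR K%:R / x)).+1; rewrite mulrC -ltr_pdivrMr//.
  exact: truncnS_gt.
have := PA n; rewrite -fA lee_fin => xn.
have en : (n%:R * expR (- n%:R) <= 1 :> R)%R.
  have := expR_ge1Dx (n%:R : R); rewrite -(@ler_pM2r _ (expR (- n%:R))) ?expR_gt0//.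
  rewrite -expRD subrr expR0; apply: le_trans; apply: ler_wpM2r; first exact: expR_ge0.
  by rewrite lerDr.
have n0 : (0 <= n%:R :> R)%R by [].
have eK := expR_ge0 (K%:R : R).
have : (x * n%:R <= expR K%:R * (n%:R * expR (- n%:R)))%R.
  by rewrite mulrCA mulrC; exact: ler_wpM2l.
have : (expR K%:R * (n%:R * expR (- n%:R)) <= expR K%:R :> R)%R by rewrite ler_piMr.
lra.
Qed.

End null_sets.

(** * Bounds on the Laplace transform of the ruin probability *)

Section ruin_sandwich.
Context d (T : measurableType d) (R : realType) (P : probability T R).
Variables (alpha1 alpha2 lambda C1 C2 u c mu s y h : R).
Variables (D : R -> T -> R) (N : R -> T -> nat) (X : nat -> T -> R).
Local Notation psi := (laplace_exponent C1 C2 alpha1 alpha2).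
Local Notation z := (s + c * (mu * (1 - y))).
Hypotheses (lambda_gt0 : 0 < lambda) (u_gt0 : 0 < u) (c_gt0 : 0 < c).
Hypotheses (mu_gt0 : 0 < mu) (h_gt0 : 0 < h) (s_gt0 : 0 < s).
Hypotheses (y_gt0 : 0 < y) (y_lt1 : y < 1).
Hypothesis psi_ge0 : forall q, 0 <= psi q.
Hypothesis psi_1 : psi 1 = 1.
Hypothesis psi_z : psi z = lambda * y^-1 - lambda.
Hypothesis D_mixed : mixed_stable_subordinator P C1 C2 alpha1 alpha2 D.
Hypothesis N_poisson : poisson_process P lambda N.
Hypothesis N_indep_Y : independent_systems P
  (sigma_of (@time R) N) (sigma_of (@time R) (inverse_subordinator D)).
Hypothesis mX : forall i, measurable_fun setT (X i).
Hypothesis X_indep : mutually_independent P X.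
Hypothesis X_law : forall i B, measurable B ->
  P (X i @^-1` B) = exponential_prob mu B.
Hypothesis X_indep_M : independent_systems P
  (sigma_of setT X) (sigma_of (@time R) (mixed_fractional_poisson N D)).
Local Notation P3 := (product_probability (product_probability P P) P).
Local Open Scope ereal_scope.

Let D_levy : levy_process P D. Proof. by case: D_mixed => -[]. Qed.
Let D_nd : nondecreasing_paths D. Proof. by case: D_mixed => -[]. Qed.
Let mD t : (0 <= t)%R -> measurable_fun setT (D t).
Proof. exact: (levy_measurable D_levy). Qed.
Let mN t : (0 <= t)%R -> measurable_fun setT (N t).
Proof. exact: (measurable_poisson N_poisson). Qed.
Let N_nd w t t' : (0 <= t)%R -> (t <= t')%R -> (N t w <= N t' w)%N.
Proof. exact: (poisson_path_nondecreasing N_poisson). Qed.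
Let N_right w t : (0 <= t)%R ->
  exists2 e : R, (0 < e)%R & forall t', (t <= t' < t + e)%R -> N t' w = N t w.
Proof. exact: (poisson_path_right N_poisson). Qed.

Let grid_ge0 (i : nat) : (0 <= i%:R * h)%R. Proof. by rewrite mulr_ge0// ltW. Qed.

Let count a j (w : T) : nat := N ((j + a)%:R * h) w.
Let gridD j (w : T) : R := D (j%:R * h) w.
Let tau j (w : T * T * T) : R := gridD j w.1.2.
Let ruined a j : set (T * T * T) := [set w | chain_ruined u c X (count a) gridD j w].
Local Notation mass a j := (chain_ruin_mass P s u c X (count a) gridD j).
Local Notation E := (split_ruin_event u c N D X).

Let mgridD j : measurable_fun setT (gridD j). Proof. exact: mD. Qed.

Let mflag a j : measurable_fun setT (chain_ruined u c X (count a) gridD j).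
Proof.
apply: (measurable_random_ruined (J := j) (n := count a)
  (b := fun j w => u + c * gridD j w)%R) => // i _; first exact: mN.
by apply: measurable_funD => //; exact: measurable_funM.
Qed.

Let mruined a j : measurable (ruined a j).
Proof.
rewrite -[X in measurable X]setTI.
by have /(_ measurableT [set true]) := @mflag a j; apply.
Qed.

Let mtau j : measurable_fun setT (tau j).
Proof.
apply: (measurableT_comp (mgridD j)).
exact: (measurableT_comp measurable_snd measurable_fst).
Qed.

Let tau_ge0 j w : (0 <= tau j w)%R.
Proof. by rewrite -(levy_start D_levy w.1.2); apply: D_nd. Qed.

Let massE a j :
  \int[P3]_w ((expR (- s * tau j w))%:E * (\1_(ruined a j) w)%:E) = mass a j.
Proof.
have mI : measurable_fun setT (fun w : T * T * T =>
    (expR (- s * tau j w))%:E * (\1_(ruined a j) w)%:E).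
  apply: emeasurable_funM; apply/measurable_EFinP; last exact: measurable_indic.
  by apply: measurableT_comp => //; exact: measurable_funM.
have I0 w : 0 <= (expR (- s * tau j w))%:E * (\1_(ruined a j) w)%:E.
  by rewrite mule_ge0 ?lee_fin ?expR_ge0.
rewrite (integral_product12 _ P mI I0).
have flagE w : (\1_(ruined a j) w)%:E =
    ((chain_ruined u c X (count a) gridD j w)%:R)%:E :> \bar R.
  rewrite indicE; congr ((nat_of_bool _)%:R%:E).
  by apply/idP/idP; rewrite in_setE.
have mW : measurable_fun setT (fun w : T * T => (expR (- s * gridD j w.2))%:E *
    \int[P]_w3 (chain_ruined u c X (count a) gridD j (w, w3))%:R%:E).
  apply: emeasurable_funM; last exact: measurable_flag_integral.
  apply/measurable_EFinP; apply: measurableT_comp => //.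
  by apply: measurable_funM => //; exact: measurableT_comp.
rewrite (eq_integral (fun w : T * T => (expR (- s * gridD j w.2))%:E *
    \int[P]_w3 (chain_ruined u c X (count a) gridD j (w, w3))%:R%:E)); last first.
  move=> w _; under eq_integral do rewrite flagE; rewrite /tau /=.
  rewrite ge0_integralZl ?lee_fin ?expR_ge0//.
  apply/measurable_EFinP; apply: measurable_boolR.
  exact: (measurableT_comp (@mflag a j) (pair1_measurable w)).
rewrite integral_product12// => w.
by rewrite mule_ge0 ?lee_fin ?expR_ge0//; apply: integral_ge0 => w3 _; rewrite lee_fin.
Qed.

Let negX := [set w | exists i, (X i w < 0)%R].
Let boundedD := [set w | exists K : nat, forall n : nat, (D n%:R w <= K%:R)%R].
(* Off [Z] the claims are nonnegative and the path of the subordinator is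
   unbounded, so that grid ruin and ruin compare path by path. *)
Let Z : set (T * T * T) := (setT `*` negX) `|` ((setT `*` boundedD) `*` setT).

Let negX_null := negative_claim_null mX X_law.

Let boundedD_null : measurable boundedD /\ P boundedD = 0.
Proof.
apply: bounded_path_null => // t t0; case: D_mixed => _ /(_ 1%R t ler01 t0).
by rewrite unlock -/(psi 1) psi_1 mulr1.
Qed.

Let mZ : measurable Z.
Proof.
apply: measurableU; apply: measurableX => //; first exact: negX_null.1.
apply: measurableX => //; exact: boundedD_null.1.
Qed.

Let Z_null : P3 Z = 0.
Proof.
apply/eqP; rewrite eq_le measure_ge0 andbT.
have m1 : measurable (setT `*` negX : set (T * T * T)).
  by apply: measurableX => //; exact: negX_null.1.
have m2 : measurable (setT `*` boundedD : set (T * T)).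
  by apply: measurableX => //; exact: boundedD_null.1.
apply: (@le_trans _ _ (P3 (setT `*` negX) + P3 ((setT `*` boundedD) `*` setT))).
  by apply: measureU2 => //; exact: measurableX.
rewrite !product_probabilityX//; last 2 first.
- exact: boundedD_null.1.
- exact: negX_null.1.
by rewrite negX_null.2 boundedD_null.2 !mule0 mul0e adde0.
Qed.

Let claims_ge0 w : ~ Z w -> forall i, (0 <= X i w.2)%R.
Proof.
by move=> Zw i; rewrite leNgt; apply/negP => Xi; apply: Zw; left; split => //; exists i.
Qed.

Let unbounded w : ~ Z w -> forall K, exists2 t, (0 <= t)%R & (K < D t w.1.2)%R.
Proof.
move=> Zw K; apply: contrapT => H; apply: Zw; right; split => //; split => //.
exists (Num.truncn K).+1 => n; rewrite leNgt; apply/negP => Kn; apply: H.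
by exists n%:R => //; apply: lt_trans Kn; exact: truncnS_gt.
Qed.

Let E_nd t t' : (t <= t')%R -> E t `<=` E t'.
Proof. by move=> tt' w /le_trans; apply; rewrite lee_fin. Qed.

Let mE t : measurable (E t).
Proof. exact: measurable_split_ruin_event. Qed.

Lemma laplace_split : laplace_transform (ruin_probability P
    (risk_process u c (mixed_fractional_poisson N D) X)) s =
  laplace_transform (fun t => P3 (E t)) s.
Proof.
congr laplace_transform; apply/funext => t.
exact: ruin_probability_split.
Qed.

Let ruined_trivIset a : trivIset setT (ruined a).
Proof.
by move=> i j _ _ [w [/= Ri Rj]]; exact: ruined_at_once Ri Rj.
Qed.

Let E_le_ruined t : E t `<=`
  (\bigcup_j (ruined 1 j `&` [set w | (tau j w <= t)%R])) `|` Z.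
Proof.
move=> w Ew; have [Zw|Zw] := pselect (Z w); [by right|left].
have [j [rj tj]] := ruin_grid_ruin (h := h) (f := D^~ w.1.2) (N := N^~ w.1.1)
  (x := X^~ w.2) u_gt0 c_gt0 h_gt0 (N_nd w.1.1) (@D_nd w.1.2) (claims_ge0 Zw)
  (poisson_path_start N_poisson _) Ew.
exists j => //; split => //; rewrite /ruined/= /chain_ruined /count.
by under [in X in ruined_at _ X _ _]eq_fun do rewrite addn1.
Qed.

Let ruined_le_E j t : (ruined 0 j `&` [set w | (tau j w <= t)%R]) `<=` E t `|` Z.
Proof.
move=> w [rj tj]; have [Zw|Zw] := pselect (Z w); [by right|left].
apply: (E_nd tj).
have T_le := grid_ruin_ruin (h := h) (f := D^~ w.1.2) (N := N^~ w.1.1)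
  (x := X^~ w.2) c_gt0 h_gt0 (N_nd w.1.1) (@D_nd w.1.2) (claims_ge0 Zw) (j := j).
apply: T_le.
- by rewrite (levy_start D_levy).
- exact: unbounded.
move: rj; rewrite /ruined/= /chain_ruined /count.
by under [in X in ruined_at _ X _ _]eq_fun do rewrite addn0.
Qed.

Let kappa_ge0 : (0 <= y^-1 * expR (mu * (1 - y) * u))%R.
Proof. by rewrite mulr_ge0 ?expR_ge0// invr_ge0 ltW. Qed.

Let mass_ge0 a j : 0 <= mass a j.
Proof.
rewrite -massE; apply: integral_ge0 => w _.
by rewrite mule_ge0 ?lee_fin ?expR_ge0.
Qed.

Local Notation laplace_ruin := (laplace_transform (ruin_probability P
  (risk_process u c (mixed_fractional_poisson N D) X)) s).

(** Ruin implies grid ruin when the count runs one step ahead. *)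
Lemma laplace_ruin_le :
  (y^-1 * expR (mu * (1 - y) * u))%:E * (s%:E * laplace_ruin) <=
  (expR (lambda * h * y^-1 - lambda * h))%:E.
Proof.
have := laplace_le_sum s_gt0 mE mZ E_nd Z_null (mruined 1) mtau tau_ge0.
move=> /(_ (fun t _ => @E_le_ruined t)); rewrite -laplace_split.
under eq_eseriesr do rewrite massE.
rewrite nneseriesZl// => L_le.
apply: (@le_trans _ _ ((y^-1 * expR (mu * (1 - y) * u))%:E *
    \sum_(j <oo) mass 1 j)).
  apply: lee_wpmul2l; first by rewrite lee_fin.
  apply: (@le_trans _ _ (s%:E * ((s^-1)%:E * \sum_(j <oo) mass 1 j))).
    by apply: lee_wpmul2l => //; rewrite lee_fin ltW.
  by rewrite muleA -EFinM divff ?gt_eqF// mul1e.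
rewrite -nneseriesZl//; apply: lime_le.
  by apply: is_cvg_nneseries => j _ _; rewrite mule_ge0.
apply: nearW => J; rewrite big_mkord -ge0_sume_distrr//.
exact: (grid_ruin_mass_le lambda_gt0 u_gt0 c_gt0 mu_gt0 h_gt0 s_gt0 y_gt0 y_lt1
  psi_z D_mixed N_poisson mX X_indep X_law).
Qed.

(** Grid ruin implies ruin when the count is read at the grid point itself. *)
Lemma laplace_ruin_ge J :
  1 <= (y^-1 * expR (mu * (1 - y) * u))%:E * (s%:E * laplace_ruin) +
  (expR (mu * (1 - y) * u) * (expR (- h * psi s) ^+ J +
     J%:R * ((lambda * h * y^-1) ^+ 2 * expR (lambda * h * y^-1))))%:E.
Proof.
have := grid_ruin_mass_ge lambda_gt0 u_gt0 c_gt0 mu_gt0 h_gt0 s_gt0 y_gt0 y_lt1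
  psi_ge0 psi_z D_mixed N_poisson mX X_indep X_law J.
move=> /le_trans; apply; apply: leeD => //; apply: lee_wpmul2l; first by rewrite lee_fin.
have := laplace_ge_sum s_gt0 mE mZ E_nd Z_null (mruined 0) mtau tau_ge0 J.+1
  (@ruined_trivIset 0) (fun j t _ => @ruined_le_E j t).
rewrite -laplace_split; under eq_bigr do rewrite massE.
rewrite -ge0_sume_distrr// => L_ge.
apply: (@le_trans _ _ (s%:E * ((s^-1)%:E * \sum_(j < J.+1) mass 0 j))).
  by rewrite muleA -EFinM divff ?gt_eqF// mul1e.
by apply: lee_wpmul2l => //; rewrite lee_fin ltW.
Qed.

End ruin_sandwich.

(** * Letting the mesh tend to zero *)

Section squeeze.
Context {R : realType}.
Variables (x : R).

Lemma le1_of_le_expR (k : R) : 0 <= k -> (forall h, 0 < h -> x <= expR (k * h)) -> x <= 1.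
Proof.
move=> k0 H; rewrite leNgt; apply/negP => x1.
have l0 : 0 < ln x by rewrite ln_gt0.
have k10 : 0 < 2 * (k + 1) by rewrite mulr_gt0// ltr_wpDl.
have := H _ (divr_gt0 l0 k10); rewrite -[X in X <= _ -> _]lnK ?posrE ?(lt_trans ltr01)//.
rewrite ler_expR leNgt => /negP; apply.
rewrite mulrCA gtr_pMr// ltr_pdivrMr//; lra.
Qed.

Lemma ge1_of_grid_error (A b p : R) : 0 <= A -> 0 <= b -> 0 < p ->
  (forall (h : R) (J : nat), 0 < h -> 1 <= x + A * (expR (- h * p) ^+ J +
     J%:R * ((b * h) ^+ 2 * expR (b * h)))) -> 1 <= x.
Proof.
move=> A0 b0 p0 H; rewrite leNgt; apply/negP => x1.
pose C := A * (p^-1 + b ^+ 2 * expR b).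
have C0 : 0 <= C.
  by rewrite mulr_ge0// addr_ge0// ?invr_ge0 ?(ltW p0)// mulr_ge0 ?expR_ge0 ?exprn_ge0.
pose m := (Num.truncn (C / (1 - x))).+1.
have m0 : 0 < m%:R :> R by rewrite ltr0n.
have mneq0 : m%:R != 0 :> R by rewrite gt_eqF.
have Cm : C < m%:R * (1 - x) by rewrite -ltr_pdivrMr ?subr_gt0// truncnS_gt.
have h0 : 0 < (m%:R ^+ 2)^-1 :> R by rewrite invr_gt0 exprn_gt0.
have := H _ (m ^ 3)%N h0.
(* h = 1/m^2 and J = m^3: the horizon J h = m tends to infinity, while the
   J per-step errors of order h^2 add up to order 1/m. *)
have e1 : expR (- (m%:R ^+ 2)^-1 * p) ^+ (m ^ 3)%N <= p^-1 / m%:R.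
  rewrite -expRM_natl natrX.
  rewrite (_ : _ * _ = - (m%:R * p)); last by field.
  rewrite expRN -invfM lef_pV2 ?posrE ?expR_gt0 ?mulr_gt0// mulrC.
  by apply: le_trans (expR_ge1Dx _); rewrite lerDr.
have e2 : (m ^ 3)%:R * ((b * (m%:R ^+ 2)^-1) ^+ 2 * expR (b * (m%:R ^+ 2)^-1)) <=
    b ^+ 2 * expR b / m%:R.
  rewrite natrX (_ : _ * _ = b ^+ 2 * expR (b * (m%:R ^+ 2)^-1) / m%:R); last by field.
  rewrite ler_pM2r ?invr_gt0// ler_wpM2l ?exprn_ge0// ler_expR ler_piMr//.
  by rewrite invf_le1 ?exprn_gt0// exprn_ege1// ler1n.
move=> /le_trans/(_ (lerD (lexx x) (ler_wpM2l A0 (lerD e1 e2)))).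
rewrite -mulrDl mulrA -/C; apply/negP; rewrite -ltNge -ltrBrDl.
by rewrite ltr_pdivrMr// mulrC.
Qed.

End squeeze.

(** * The equation for y *)

Section ruin_equation.
Context {R : realType}.
Variables (alpha1 alpha2 lambda C1 C2 c mu s : R).
Hypotheses (lambda_gt0 : 0 < lambda) (C1_ge0 : 0 <= C1) (C2_ge0 : 0 <= C2).
Hypotheses (C12 : C1 + C2 = 1) (c_gt0 : 0 < c) (mu_gt0 : 0 < mu) (s_gt0 : 0 < s).
Local Notation psi := (laplace_exponent C1 C2 alpha1 alpha2).

Lemma laplace_exponent_ge0 q : 0 <= psi q.
Proof. by rewrite addr_ge0// mulr_ge0// powR_ge0. Qed.

Lemma laplace_exponent_gt0 q : 0 < q -> 0 < psi q.
Proof.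
move=> q0; have p1 := powR_gt0 alpha1 q0; have p2 := powR_gt0 alpha2 q0.
have [C10|C1n] := eqVneq C1 0; last first.
  by rewrite ltr_pwDl ?mulr_ge0 ?(ltW p2)// mulr_gt0// lt_neqAle eq_sym C1n.
have C21 : C2 = 1 by rewrite -C12 C10 add0r.
by rewrite /laplace_exponent C10 C21 mul0r add0r mul1r.
Qed.

Lemma laplace_exponent1 : psi 1 = 1.
Proof. by rewrite /laplace_exponent !powR1 !mulr1. Qed.

(** Nonnegativity of psi gives [y <= 1], hence [z >= s > 0], hence psi z > 0
    and [y < 1]; then the equation can be solved for psi z. *)
Lemma solution_in_unit y : solves_ruin_equation C1 C2 alpha1 alpha2 lambda mu c s y ->
  [/\ 0 < y, y < 1 & psi (s + c * (mu * (1 - y))) = lambda * y^-1 - lambda].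
Proof.
case; rewrite -/(psi _) -mulrA; set z := s + _ => z0 yE.
have den0 : 0 < psi z + lambda by rewrite ltr_wpDl// laplace_exponent_ge0.
have y0 : 0 < y by rewrite yE divr_gt0.
have y1 : y <= 1.
  by rewrite yE ler_pdivrMr// mul1r lerDr laplace_exponent_ge0.
have z_gt0 : 0 < z.
  by rewrite ltr_pwDl// !mulr_ge0 ?(ltW c_gt0) ?(ltW mu_gt0)// subr_ge0.
have psi0 := laplace_exponent_gt0 z_gt0.
split => //; first by rewrite yE ltr_pdivrMr// mul1r ltrDr.
by rewrite [in RHS]yE invf_div; field; rewrite gt_eqF.
Qed.

(** Intermediate value theorem on the unit interval: the right-hand side is
    positive at [y = 0] and at most 1 at [y = 1]. *)
Lemma solution_exists :
  exists y, solves_ruin_equation C1 C2 alpha1 alpha2 lambda mu c s y.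
Proof.
pose Z y := s + c * mu * (1 - y).
pose F y := lambda / (psi (Z y) + lambda) - y.
have Z_gt0 y : y <= 1 -> 0 < Z y.
  by move=> y1; rewrite ltr_pwDl// !mulr_ge0 ?(ltW c_gt0) ?(ltW mu_gt0)// subr_ge0.
have den0 q : 0 < psi q + lambda by rewrite ltr_wpDl// laplace_exponent_ge0.
have cZ y : {for y, continuous Z}.
  apply: (@continuousD _ R^o R (fun=> s)); first exact: cst_continuous.
  apply: (@continuousM _ R (fun=> c * mu)); first exact: cst_continuous.
  apply: (@continuousB _ R^o R (fun=> 1)); first exact: cst_continuous.
  exact: cvg_id.
have cpow a y : y <= 1 -> {for y, continuous (fun y => Z y `^ a)}.
  move=> y1; apply: (@continuous_comp _ _ _ Z (fun q => q `^ a)); first exact: cZ.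
  apply: differentiable_continuous; apply/derivable1_diffP.
  by apply: derivable_powR; rewrite in_itv/= andbT Z_gt0.
have cF : {within `[0, 1], continuous F}.
  apply: continuous_in_subspaceT => y; rewrite inE/= in_itv/= => /andP[_ y1].
  have cpsi : {for y, continuous (fun y => psi (Z y) + lambda)}.
    apply: (@continuousD _ R^o R (fun y => psi (Z y)) (fun=> lambda)); last exact: cst_continuous.
    apply: (@continuousD _ R^o R (fun y => C1 * Z y `^ alpha1) (fun y => C2 * Z y `^ alpha2)).
      apply: (@continuousM _ R (fun=> C1)); [exact: cst_continuous|exact: cpow].
    apply: (@continuousM _ R (fun=> C2)); [exact: cst_continuous|exact: cpow].
  apply: (@continuousB _ R^o R (fun y => lambda / (psi (Z y) + lambda)) id); last exact: cvg_id.
  apply: (@continuousM _ R (fun=> lambda) (fun y => (psi (Z y) + lambda)^-1)).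
    exact: cst_continuous.
  by apply: continuousV cpsi; rewrite gt_eqF.
have F0 : 0 <= F 0 by rewrite /F subr0 divr_ge0 ?ltW.
have F1 : F 1 <= 0.
  by rewrite /F subr_le0 ler_pdivrMr// mul1r lerDr laplace_exponent_ge0.
have [|y] := IVT ler01 cF (v := 0).
  by rewrite ge_min F1 orbT le_max F0.
rewrite in_itv/= => /andP[_ y1] /eqP; rewrite subr_eq0 => /eqP yE.
by exists y; split; [exact/ltW/Z_gt0|rewrite -[LHS]yE].
Qed.

End ruin_equation.

(** * The Laplace transform of the ruin probability *)

(** As the mesh tends to 0 both bounds force y^-1 e^{ru} s L = 1, where L is the
    Laplace transform and r = mu (1 - y). *)
Lemma laplace_ruin_probability (R : realType) d (T : measurableType d)
    (P : probability T R) (alpha1 alpha2 lambda C1 C2 u c mu s y : R)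
    (D : R -> T -> R) (N : R -> T -> nat) (X : nat -> T -> R) :
  0 < lambda -> 0 <= C1 -> 0 <= C2 -> C1 + C2 = 1 ->
  0 < u -> 0 < c -> 0 < mu -> 0 < s ->
  mixed_stable_subordinator P C1 C2 alpha1 alpha2 D ->
  poisson_process P lambda N ->
  independent_systems P
    (sigma_of (@time R) N) (sigma_of (@time R) (inverse_subordinator D)) ->
  (forall i, measurable_fun setT (X i)) ->
  mutually_independent P X ->
  (forall i B, measurable B -> P (X i @^-1` B) = exponential_prob mu B) ->
  independent_systems P
    (sigma_of setT X) (sigma_of (@time R) (mixed_fractional_poisson N D)) ->
  solves_ruin_equation C1 C2 alpha1 alpha2 lambda mu c s y ->
  laplace_transform (ruin_probability P
    (risk_process u c (mixed_fractional_poisson N D) X)) s =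
  (s^-1 * y * expR (- (u * mu * (1 - y))))%:E.
Proof.
move=> lambda_gt0 C1_ge0 C2_ge0 C12 u_gt0 c_gt0 mu_gt0 s_gt0 D_mixed N_poisson
  N_indep_Y mX X_indep X_law X_indep_M y_sol.
have [y_gt0 y_lt1 psi_z] :=
  solution_in_unit lambda_gt0 C1_ge0 C2_ge0 C12 c_gt0 mu_gt0 s_gt0 y_sol.
have psi_ge0 := laplace_exponent_ge0 alpha1 alpha2 C1_ge0 C2_ge0.
have psi_1 := laplace_exponent1 alpha1 alpha2 C12.
have psi_s := laplace_exponent_gt0 alpha1 alpha2 C1_ge0 C2_ge0 C12 s_gt0.
have upper h (h_gt0 : 0 < h) := laplace_ruin_le lambda_gt0 u_gt0 c_gt0 mu_gt0 h_gt0
  s_gt0 y_gt0 y_lt1 psi_1 psi_z D_mixed N_poisson N_indep_Y mX X_indep X_law X_indep_M.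
have lower h (h_gt0 : 0 < h) := laplace_ruin_ge lambda_gt0 u_gt0 c_gt0 mu_gt0 h_gt0
  s_gt0 y_gt0 y_lt1 psi_ge0 psi_1 psi_z D_mixed N_poisson N_indep_Y mX X_indep X_law
  X_indep_M.
move: upper lower; set L := laplace_transform _ _; set E := expR _.
have E_gt0 : 0 < E by exact: expR_gt0.
have kappa_gt0 : 0 < y^-1 * E * s by rewrite !mulr_gt0// invr_gt0.
have L_ge0 : (0 <= L)%E.
  by apply: integral_ge0 => t _; rewrite mule_ge0 ?lee_fin ?expR_ge0// measure_ge0.
case: L L_ge0 => [l||//] L_ge0 upper lower; last first.
  by have := upper _ ltr01; rewrite muleA -EFinM gt0_muley ?lte_fin.
have l1 : y^-1 * E * (s * l) = 1.
  apply/eqP; rewrite eq_le; apply/andP; split.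
    apply: (@le1_of_le_expR _ _ (lambda * (y^-1 - 1))).
      by rewrite mulr_ge0 ?(ltW lambda_gt0)// subr_ge0 invf_ge1// ltW.
    move=> h /upper; rewrite -!EFinM lee_fin => /le_trans; apply.
    by rewrite ler_expR mulrBr mulr1 mulrBl mulrAC.
  apply: (ge1_of_grid_error (A := E) (b := lambda * y^-1)
    (p := laplace_exponent C1 C2 alpha1 alpha2 s)).
  - exact: ltW.
  - by rewrite mulr_ge0 ?invr_ge0 ?(ltW lambda_gt0)// ltW.
  - exact: psi_s.
  move=> h J /lower/(_ J); rewrite -!EFinM -EFinD lee_fin.
  by rewrite (mulrAC lambda h).
congr (_%:E).
have -> : expR (- (u * mu * (1 - y))) = E^-1.
  by rewrite /E -expRN; congr expR; ring.
have -> : l = (y^-1 * E * (s * l)) * (s^-1 * y * E^-1).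
  by field; rewrite !gt_eqF.
by rewrite l1 mul1r.
Qed.

Theorem mainTheorem9 (R : realType) (d : measure_display)
    (Omega : measurableType d) (P : probability Omega R)
    (alpha1 alpha2 lambda C1 C2 u c mu : R)
    (D : R -> Omega -> R) (N : R -> Omega -> nat) (X : nat -> {RV P >-> R})
    (alpha2_gt0 : 0 < alpha2) (alpha21 : alpha2 < alpha1)
    (alpha1_lt1 : alpha1 < 1) (lambda_gt0 : 0 < lambda)
    (C1_ge0 : 0 <= C1) (C2_ge0 : 0 <= C2) (C12 : C1 + C2 = 1)
    (u_gt0 : 0 < u) (c_gt0 : 0 < c) (mu_gt0 : 0 < mu)
    (D_mixed_stable : mixed_stable_subordinator P C1 C2 alpha1 alpha2 D)
    (N_poisson : poisson_process P lambda N)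
    (N_indep_Y : independent_systems P
       (sigma_of (@time R) N)
       (sigma_of (@time R) (inverse_subordinator D)))
    (X_iid : iid_exponential mu X)
    (X_indep_MFPP : independent_systems P
       (sigma_of setT (fun (i : nat) => X i : Omega -> R))
       (sigma_of (@time R) (mixed_fractional_poisson N D))) :
  let psi := ruin_probability P
    (risk_process u c (mixed_fractional_poisson N D)
       (fun (i : nat) => X i : Omega -> R)) in
  forall s : R, 0 < s ->
    (exists y : R,
       solves_ruin_equation C1 C2 alpha1 alpha2 lambda mu c s y) /\
    (forall y : R,
       solves_ruin_equation C1 C2 alpha1 alpha2 lambda mu c s y ->
       laplace_transform psi s =
       (s^-1 * y * expR (- (u * mu * (1 - y))))%:E).
Proof.
move=> psi s s_gt0; split; first exact: solution_exists.
case: X_iid => X_mut X_law y.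
by apply: (laplace_ruin_probability (lambda := lambda)).
Qed.
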